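(* Let $\Delta$ be a matroid on $[n]=\{1,\ldots,n\}$ such that the Cohen–Macaulay type of $S/I_\Delta$ satisfies $\operatorname{type}(S/I_\Delta)\le 3$. Then the $h$-vector of $\Bbbk[\Delta]=S/I_\Delta$ is a pure $O$-sequence. Equivalently, if $\Delta$ is a matroid and the $h$-vector of $\Bbbk[\Delta]$ has the shape $(1,h_1,\ldots,h_s)$ with last nonzero entry $h_s\le 3$, then it is a pure $O$-sequence.
   Context: A matroid on $[n]$ is identified with its simplicial complex $\Delta$ of independent sets: a simplicial complex such that for any $F,G\in\Delta$ with $|F|<|G|$ there is $i\in G\setminus F$ with $F\cup\{i\}\in\Delta$. $\Bbbk$ is a field, $S=\Bbbk[x_1,\ldots,x_n]$, and $I_\Delta=(\prod_{i\in F}x_i : F\subseteq[n],\ F\notin\Delta)$ is the Stanley–Reisner ideal. The $h$-vector of $\Bbbk[\Delta]$ is the vector $(h_0,\ldots,h_s)$ with $h_s\ne0$ such that the Hilbert series of $\Bbbk[\Delta]$ equals $\frac{h_0+h_1t+\cdots+h_st^s}{(1-t)^{\dim\Delta+1}}$. The ring $S/I_\Delta$ is Cohen–Macaulay for a matroid $\Delta$; its type is the last nonzero total Betti number of the minimal graded free resolution of $S/I_\Delta$ over $S$. An order ideal is a finite set of monomials (in finitely many variables) closed under taking divisors; it is pure if all its maximal (with respect to divisibility) monomials have the same degree. Its $f$-vector is $(f_0,\ldots,f_s)$, where $f_i$ is the number of its monomials of degree $i$. A pure $O$-sequence is the $f$-vector of a pure order ideal. *)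

(* Defs.v *)
From mathcomp Require Import all_boot all_order all_algebra.
From mathcomp Require Import finmap.
From mathcomp Require Import mpoly.

Set Implicit Arguments.
Unset Strict Implicit.
Unset Printing Implicit Defensive.

Import Order.TTheory GRing.Theory Num.Theory.

Local Open Scope ring_scope.

(* The ground set {1, ..., n} is 'I_n. Loops are allowed: a singleton need not
   belong to the complex. *)
Definition simplicial_complex (n : nat) (Delta : {set {set 'I_n}}) : Prop :=
  set0 \in Delta /\
  forall F G : {set 'I_n}, G \in Delta -> F \subset G -> F \in Delta.

Definition matroid (n : nat) (Delta : {set {set 'I_n}}) : Prop :=
  simplicial_complex Delta /\
  forall F G : {set 'I_n}, F \in Delta -> G \in Delta -> (#|F| < #|G|)%N ->
    exists2 i, i \in G :\: F & i |: F \in Delta.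

(* dim Delta + 1 *)
Definition complex_rank (n : nat) (Delta : {set {set 'I_n}}) : nat :=
  \max_(F in Delta) #|F|.

Definition SR_ideal (k : fieldType) (n : nat) (Delta : {set {set 'I_n}})
    (p : {mpoly k[n]}) : Prop :=
  exists c : {set 'I_n} -> {mpoly k[n]},
    p = \sum_(F | F \notin Delta) c F * \prod_(i in F) 'X_i.

(* dim_k (S/I)_d = N: there are N forms of degree d whose classes modulo I are
   a basis of (S/I)_d. *)
Definition quotient_dim (k : fieldType) (n : nat) (I : {mpoly k[n]} -> Prop)
    (d N : nat) : Prop :=
  exists b : 'I_N -> {mpoly k[n]},
    [/\ forall j, b j \is d.-homog,
        forall c : 'I_N -> k, I (\sum_j c j *: b j) -> forall j, c j = 0
      & forall p, p \is d.-homog ->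
          exists c : 'I_N -> k, I (p - \sum_j c j *: b j)].

(* The series H(t) = sum_d H d t^d satisfies H(t) (1 - t)^r = sum_i h_i t^i,
   with r = dim Delta + 1; the product of power series is written
   coefficientwise, and h`_i = 0 for i >= size h. *)
Definition is_h_vector (k : fieldType) (n : nat) (Delta : {set {set 'I_n}})
    (h : seq int) : Prop :=
  last 0 h != 0 /\
  exists H : nat -> nat,
    (forall d, quotient_dim (@SR_ideal k n Delta) d (H d)) /\
    forall i, \sum_(j < i.+1)
      ((1 - 'X : {poly int}) ^+ complex_rank Delta)`_j * (H (i - j)%N)%:Z = h`_i.

(* A resolution ... -> F_1 -> F_0 = S -> S/I -> 0 by graded free modules
   F_i = (+)_(c < betti i) S(- shift c). The elements of F_i are row vectors,
   and diff i : F_(i+1) -> F_i acts on them from the right. The shifts in a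
   minimal resolution of S/I are never negative. *)
Record min_graded_free_resolution (k : fieldType) (n : nat)
    (I : {mpoly k[n]} -> Prop) := MinGradedFreeResolution {
  betti : nat -> nat;
  shift : forall i, 'I_(betti i) -> nat;
  diff : forall i, 'M[{mpoly k[n]}]_(betti i.+1, betti i);
  _ : betti 0 = 1%N;
  _ : forall c : 'I_(betti 0), shift c = 0%N;
  (* the entry (r, c) of diff i is homogeneous of degree shift r - shift c,
     hence zero if that difference is negative *)
  _ : forall i r c m, m \in msupp (diff i r c) ->
        (mdeg m + shift c)%N = shift r;
  _ : forall w : 'rV[{mpoly k[n]}]_(betti 0),
        (forall c, I (w 0 c)) <-> exists v, w = v *m diff 0;
  _ : forall i (w : 'rV[{mpoly k[n]}]_(betti i.+1)),
        w *m diff i = 0 <-> exists v, w = v *m diff i.+1;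
  (* minimality: the image of diff i lies in (x_1, ..., x_n) F_i *)
  _ : forall i r c, (diff i r c)@_0%MM = 0
}.

(* t is the last nonzero total Betti number of S/I. *)
Definition is_type (k : fieldType) (n : nat) (I : {mpoly k[n]} -> Prop)
    (t : nat) : Prop :=
  exists (R : min_graded_free_resolution I) (p : nat),
    [/\ betti R p = t, t <> 0%N & forall i, (p < i)%N -> betti R i = 0%N].

Definition order_ideal (m : nat) (M : {fset 'X_{1..m}}) : Prop :=
  forall u v : 'X_{1..m}, (u <= v)%MM -> v \in M -> u \in M.

Definition maximal_monomial (m : nat) (M : {fset 'X_{1..m}})
    (u : 'X_{1..m}) : Prop :=
  u \in M /\ forall v, v \in M -> (u <= v)%MM -> v = u.

Definition pure (m : nat) (M : {fset 'X_{1..m}}) : Prop :=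
  forall u v, maximal_monomial M u -> maximal_monomial M v -> mdeg u = mdeg v.

Definition f_vector (m : nat) (M : {fset 'X_{1..m}}) : seq nat :=
  mkseq (fun i => #|` [fset u in M | mdeg u == i]%fset |)
    (\max_(u <- M) mdeg u).+1.

Definition pure_O_sequence (f : seq int) : Prop :=
  exists (m : nat) (M : {fset 'X_{1..m}}),
    [/\ M != fset0, order_ideal M, pure M & f = [seq i%:Z | i <- f_vector M]].

(* Main.v *)
(* Contracting coloops changes neither the Stanley-Reisner ideal nor the h-vector,
   so let Delta be a coloop-free matroid of rank r and let T be its Tutte
   polynomial. The last entry of the h-vector is tau = T(0,1) > 0.

   The type is at least tau: deletion-contraction and mapping cones give a graded
   free resolution of length n - r, with shifts at most i + r in degree i and at
   least tau generators of degree n in homological degree n - r. These survive in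
   every minimal resolution.

   If tau <= 3, merging series classes reduces Delta to a weighted matroid with
   neither coloops nor series pairs, and there tau = tau(deletion) +
   tau(contraction) forces tau >= r + 1. After discarding loops only the empty
   matroid and U_{1,3}, U_{1,4}, U_{2,4} remain, for which pure order ideals in at
   most three variables are explicit; each loop of weight a contributes a factor
   1 + t + ... + t^(a-1), that is, a new variable. *)

Require Import Defs.
From mathcomp Require Import all_boot all_order all_algebra.
From mathcomp Require Import finmap.
From mathcomp Require Import mpoly.
From mathcomp Require Import zify ring.
From Stdlib Require Import ClassicalEpsilon.

Set Implicit Arguments.
Unset Strict Implicit.
Unset Printing Implicit Defensive.

Import Order.TTheory GRing.Theory Num.Theory.

Local Open Scope ring_scope.

(** * Deletion, contraction and the small cosimple matroids *)

Section Minors.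
Variable n : nat.
Implicit Types (D : {set {set 'I_n}}) (E F G H : {set 'I_n}) (e f : 'I_n).

(** Both halves of the theorem reduce to [tau <= 3]: the last entry of [h] is [tau], and about the
    type only the inequality [tau <= t] is used, so no minimal resolution has to be built. The cone
    resolution is in general not minimal; degrees save the count. In homological degree
    [c = #|E| - r] nothing follows, and the generators one step earlier have degree at most
    [c - 1 + r < #|E|], so a generator of degree [#|E|] cannot cancel.

    The inductions need objects closed under minors. Every minor remains a family on ['I_n] with its
    ground set [E] tracked separately, and all ideals live in the same ring, the variables outside
    [E] being free.

    The shapes of the final order ideals are suggested by [tau], which must be the number of maximal
    monomials. For U_{1,m} the ideal is a box with m - 1 sides, lengthened by the remaining weight
    in one direction at a time; for U_{2,4} it is a planar staircase with three corners. *)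

Definition del D e : {set {set 'I_n}} := [set F in D | e \notin F].
(** For a loop [e] this family is empty, unlike the matroid contraction; hence the recurring
    hypothesis [[set e] \in D]. *)
Definition lnk D e : {set {set 'I_n}} :=
  [set F : {set 'I_n} | (e \notin F) && (e |: F \in D)].
Definition coloop D e := [forall F in D, e |: F \in D].
Definition coloop_free D := forall e, ~~ coloop D e.
(** In a coloop-free matroid, a coloop of [del D f] is an element in series with [f]. *)
Definition cosimple D := forall f, coloop_free (del D f).

Lemma in_del D e F : (F \in del D e) = (F \in D) && (e \notin F).
Proof. by rewrite inE. Qed.

Lemma in_lnk D e F : (F \in lnk D e) = (e \notin F) && (e |: F \in D).
Proof. by rewrite inE. Qed.

Lemma coloopP D e : reflect (forall F, F \in D -> e |: F \in D) (coloop D e).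
Proof. exact: forall_inP. Qed.

Lemma matroid0 D : matroid D -> set0 \in D.
Proof. by case=> [[]]. Qed.

Lemma matroidS D F G : matroid D -> G \in D -> F \subset G -> F \in D.
Proof. by case=> [[_ DS] _]; apply: DS. Qed.

(** Exchange, repeated until [F] is as large as [G]. The inclusion in [F :|: G] is what later keeps
    a chosen element out of the extension. *)
Lemma matroid_extend D F G : matroid D -> F \in D -> G \in D ->
  exists H, [/\ H \in D, F \subset H, H \subset F :|: G & (#|G| <= #|H|)%N].
Proof.
move=> mD FD GD; have [k] := ubnP (#|G| - #|F|)%N.
elim: k F FD => // k IHk F FD.
case: (leqP #|G| #|F|) => [leGF _|ltFG lek]; first by exists F; rewrite subsetUl.
have [i /setDP[iG iF] iFD] := mD.2 _ _ FD GD ltFG.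
have ci : #|i |: F| = #|F|.+1 by rewrite cardsU1 iF.
have [|H [HD sFH sH leGH]] := IHk _ iFD; first by rewrite ci; lia.
exists H; split=> //; first exact: subset_trans (subsetUr _ _) sFH.
apply: subset_trans sH _; rewrite subUset subsetUr andbT.
by rewrite subUset subsetUl andbT sub1set inE iG orbT.
Qed.

Lemma leq_rank D F : F \in D -> (#|F| <= complex_rank D)%N.
Proof. by move=> FD; apply: (leq_bigmax_cond (F := fun F : {set 'I_n} => #|F|)). Qed.

Lemma rank_basis D : set0 \in D -> exists2 B, B \in D & #|B| = complex_rank D.
Proof.
move=> D0; rewrite /complex_rank; have [|B BD ->] := @eq_bigmax_cond _ (mem D) (fun F => #|F|).
  by apply/card_gt0P; exists set0.
by exists B.
Qed.

Lemma rankE D F : F \in D -> (forall G, G \in D -> (#|G| <= #|F|)%N) ->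
  complex_rank D = #|F|.
Proof.
by move=> FD maxF; apply/eqP; rewrite eqn_leq leq_rank // andbT; apply/bigmax_leqP.
Qed.

Lemma extend_basis D F : matroid D -> F \in D ->
  exists B, [/\ B \in D, F \subset B & #|B| = complex_rank D].
Proof.
move=> mD FD; have [B0 B0D cB0] := rank_basis (matroid0 mD).
have [B [BD sFB _ leB]] := matroid_extend mD FD B0D.
by exists B; split=> //; apply/eqP; rewrite eqn_leq leq_rank // -cB0.
Qed.

Lemma del_matroid D e : matroid D -> matroid (del D e).
Proof.
move=> mD; split; first split.
- by rewrite in_del matroid0 ?inE.
- move=> F G; rewrite !in_del => /andP[GD eG] sFG.
  by rewrite (matroidS mD GD sFG) (contraNN (subsetP sFG e)).
move=> F G; rewrite !in_del => /andP[FD eF] /andP[GD eG] ltFG.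
have [i iGF iFD] := mD.2 _ _ FD GD ltFG; exists i => //.
rewrite in_del iFD !inE negb_or eF andbT; case/setDP: iGF => iG _.
by apply: contraNneq eG => ->.
Qed.

Lemma lnk_matroid D e : matroid D -> [set e] \in D -> matroid (lnk D e).
Proof.
move=> mD eD; split; first split.
- by rewrite in_lnk inE setU0.
- move=> F G; rewrite !in_lnk => /andP[eG GD] sFG.
  by rewrite (contraNN (subsetP sFG e)) // (matroidS mD GD) // setUS.
move=> F G; rewrite !in_lnk => /andP[eF FD] /andP[eG GD] ltFG.
have [|i /setDP[]] := mD.2 _ _ FD GD; first by rewrite !cardsU1 eF eG.
rewrite !inE => /orP[/eqP->|iG]; first by rewrite eqxx.
rewrite negb_or => /andP[ie iF] iFD; exists i; first by rewrite inE iF.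
by rewrite in_lnk setUCA iFD !inE negb_or eq_sym ie eF.
Qed.

Lemma rank_lnk D e : matroid D -> [set e] \in D ->
  complex_rank D = (complex_rank (lnk D e)).+1.
Proof.
move=> mD eD; have [B [BD]] := extend_basis mD eD; rewrite sub1set => eB cB.
have BE : e |: (B :\ e) = B by rewrite setD1K.
have -> : complex_rank (lnk D e) = #|B :\ e|.
  apply: rankE => [|G]; first by rewrite in_lnk BE BD !inE eqxx.
  rewrite in_lnk => /andP[eG /leq_rank]; rewrite cardsU1 eG -cB (cardsD1 e B) eB.
  by rewrite leq_add2l.
by rewrite -cB (cardsD1 e B) eB.
Qed.

(** A face that cannot absorb [e] extends to a basis [B0] without [e]; growing [F] by elements of
    [B0] alone never picks up [e]. *)
Lemma coloopPn D e : matroid D -> ~~ coloop D e ->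
  forall F, F \in D -> e \notin F ->
  exists B, [/\ B \in D, F \subset B, e \notin B & #|B| = complex_rank D].
Proof.
move=> mD /forall_inPn[F0 F0D eF0D] F FD eF.
have [B0 [B0D sB0 cB0]] := extend_basis mD F0D.
have eB0 : e \notin B0.
  apply: contraNN eF0D => eB0; apply: (matroidS mD B0D).
  by rewrite subUset sub1set eB0.
have [B [BD sFB sB leB]] := matroid_extend mD FD B0D.
exists B; split=> //; last by apply/eqP; rewrite eqn_leq leq_rank // -cB0.
by apply: contraNN eF => /(subsetP sB); rewrite inE (negPf eB0) orbF.
Qed.

Lemma rank_del D e : matroid D -> ~~ coloop D e ->
  complex_rank (del D e) = complex_rank D.
Proof.
move=> mD ncl; have [|B [BD _ eB cB]] := coloopPn mD ncl (matroid0 mD).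
  by rewrite inE.
rewrite -cB; apply: rankE => [|G]; first by rewrite in_del BD.
by rewrite in_del cB => /andP[/leq_rank].
Qed.

Lemma coloop1 D e : matroid D -> coloop D e -> [set e] \in D.
Proof. by move=> mD /coloopP/(_ _ (matroid0 mD)); rewrite setU0. Qed.

Lemma coloop_del_lnk D e : matroid D -> coloop D e -> del D e = lnk D e.
Proof.
move=> mD /coloopP cl; apply/setP=> F; rewrite in_del in_lnk andbC.
case: (e \notin F) => //=; apply/idP/idP=> [/cl //|eFD].
exact: matroidS mD eFD (subsetUr _ _).
Qed.

(** If [f] is no coloop of [D], some basis misses [f]. Exchanging [e] into it gives a basis through
    [e] that still misses [f], and adding [f] to that one would exceed the rank. *)
Lemma coloop_lnk D e f : matroid D -> [set e] \in D ->
  coloop (lnk D e) f -> coloop D f.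
Proof.
move=> mD eD /coloopP cl; have /cl : set0 \in lnk D e by rewrite in_lnk inE setU0.
rewrite in_lnk !inE setU0 negb_or andbT => /andP[ef _].
apply/coloopP=> F FD; apply: contraT => fFD.
have [B [BD sFB cB]] := extend_basis mD FD.
have fB : f \notin B.
  apply: contraNN fFD => fB; apply: (matroidS mD BD).
  by rewrite subUset sub1set fB.
have [H [HD]] := matroid_extend mD eD BD; rewrite sub1set => eH sH leH.
have: H :\ e \in lnk D e by rewrite in_lnk setD1K // HD !inE eqxx.
move/cl; rewrite in_lnk setUCA setD1K // => /andP[_ /leq_rank].
have fH : f \notin H.
  by apply: contraNN fB => /(subsetP sH); rewrite !inE eq_sym (negPf ef).
by rewrite cardsU1 fH -cB leqNgt ltnS leH.
Qed.

Lemma lnk_coloop_free D e : matroid D -> [set e] \in D ->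
  coloop_free D -> coloop_free (lnk D e).
Proof. by move=> mD eD cf f; apply: contraNN (cf f); apply: coloop_lnk. Qed.

Lemma del_lnk D e f : e != f -> del (lnk D e) f = lnk (del D f) e.
Proof.
move=> ef; apply/setP=> F; rewrite in_del !in_lnk in_del in_setU1 negb_or eq_sym ef /=.
by rewrite andbA.
Qed.

Lemma delC D e f : del (del D e) f = del (del D f) e.
Proof. by apply/setP=> F; rewrite !in_del andbAC. Qed.

Lemma lnk_cosimple D e : matroid D -> [set e] \in D ->
  coloop_free D -> cosimple D -> cosimple (lnk D e).
Proof.
move=> mD eD cf cs f g; have [<-|ef] := eqVneq e f.
  suff -> : del (lnk D e) e = lnk D e by apply: lnk_coloop_free.
  by apply/setP=> F; rewrite in_del in_lnk andbAC andbb.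
rewrite del_lnk //; apply: lnk_coloop_free (cs f) g; first exact: del_matroid.
by rewrite in_del eD inE eq_sym.
Qed.

(** Being in series is symmetric: a basis avoiding both [e] and [f] would stay independent after
    adding [e], so every basis that avoids [e] contains [f]. *)
Lemma coloop_delC D e f : matroid D -> ~~ coloop D e ->
  coloop (del D f) e -> coloop (del D e) f.
Proof.
move=> mD ncl /coloopP cl; apply/coloopP=> F; rewrite in_del => /andP[FD eF].
have ef : e != f.
  have := cl set0; rewrite !in_del (matroid0 mD) setU0 !inE eq_sym.
  by case/(_ isT)/andP.
have [B [BD sFB eB cB]] := coloopPn mD ncl FD eF.
rewrite in_del !inE negb_or ef eF !andbT; apply: (matroidS mD BD).
rewrite subUset sFB andbT sub1set; apply: contraT => fB.
have := cl B; rewrite !in_del BD fB => /(_ isT)/andP[/leq_rank].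
by rewrite cardsU1 eB cB ltnn.
Qed.

Lemma sum_del_lnk (V : nmodType) (g : {set 'I_n} -> V) D e :
  \sum_(F in D) g F = \sum_(F in del D e) g F + \sum_(F in lnk D e) g (e |: F).
Proof.
rewrite (bigID (fun F : {set 'I_n} => e \notin F)) /=; congr (_ + _).
  by apply: eq_bigl => F; rewrite in_del.
rewrite (reindex_onto (fun F => e |: F) (fun F => F :\ e)) /=; last first.
  by move=> F; rewrite negbK => /andP[_ eF]; rewrite setD1K.
apply: eq_bigl => F; rewrite in_lnk !inE eqxx /= andbT andbC; congr (_ && _).
apply/eqP/idP=> [<-|eF]; first by rewrite !inE eqxx.
by rewrite setU1K.
Qed.

Lemma card_del_lnk D e : #|D| = (#|del D e| + #|lnk D e|)%N.
Proof.
have := @sum_del_lnk nat (fun=> 1%N) D e.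
by rewrite -!sum1_card.
Qed.

(* [tau D] is T(0,1) for the Tutte polynomial T of D, i.e. up to sign the
   reduced Euler characteristic of D. *)
Definition tau D : int := \sum_(F in D) (-1) ^+ (complex_rank D - #|F|).

Lemma tau_coloop D e : matroid D -> coloop D e -> tau D = 0.
Proof.
move=> mD cl; rewrite /tau (sum_del_lnk _ _ e) coloop_del_lnk //.
rewrite -big_split big1 //= => F; rewrite in_lnk => /andP[eF /leq_rank].
rewrite cardsU1 eF => leF.
(* The terms of [F] and [e |: F] have opposite signs. The truncated subtraction is exact because
   [e |: F] is a face, so [#|F|] is below the rank. *)
rewrite (_ : complex_rank D - #|F| = (complex_rank D - (1 + #|F|)).+1)%N; last by lia.
by rewrite exprS mulN1r addNr.
Qed.

Lemma tau_nonloop D e : matroid D -> [set e] \in D -> ~~ coloop D e ->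
  tau D = tau (del D e) + tau (lnk D e).
Proof.
move=> mD eD ncl; rewrite /tau (sum_del_lnk _ _ e) rank_del //; congr (_ + _).
apply: eq_bigr => F; rewrite in_lnk => /andP[eF _].
by rewrite (rank_lnk mD eD) cardsU1 eF add1n subSS.
Qed.

Lemma loopless_rank0 D : matroid D -> (forall e, [set e] \notin D) -> D = [set set0].
Proof.
move=> mD lD; apply/setP=> F; rewrite inE; apply/idP/eqP=> [FD|->]; last exact: matroid0.
apply/setP=> e; rewrite inE; apply: contraNF (lD e) => eF.
by apply: matroidS mD FD _; rewrite sub1set.
Qed.

Lemma rank_set0 : complex_rank [set set0 : {set 'I_n}] = 0%N.
Proof. by rewrite /complex_rank big_set1 cards0. Qed.

Lemma tau_set0 : tau [set set0] = 1.
Proof. by rewrite /tau rank_set0 big_set1 cards0. Qed.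

Lemma card_del_lt D e : set0 \in lnk D e -> (#|del D e| < #|D|)%N.
Proof.
move=> l0; rewrite (card_del_lnk D e) -[X in (X < _)%N]addn0 ltn_add2l.
by apply/card_gt0P; exists set0.
Qed.

Lemma card_lnk_lt D e : matroid D -> (#|lnk D e| < #|D|)%N.
Proof.
move=> mD; rewrite (card_del_lnk D e) -[X in (X < _)%N]add0n ltn_add2r.
by apply/card_gt0P; exists set0; rewrite in_del matroid0 ?inE.
Qed.

Lemma tau_ge0 D : matroid D -> 0 <= tau D.
Proof.
have [k] := ubnP #|D|; elim: k D => // k IHk D ltk mD.
have [/existsP[e eD]|/existsPn lD] := boolP [exists e, [set e] \in D]; last first.
  by rewrite (loopless_rank0 mD lD) tau_set0.
have [cl|ncl] := boolP (coloop D e); first by rewrite (tau_coloop mD cl).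
have mL := lnk_matroid mD eD.
rewrite (tau_nonloop mD eD ncl) addr_ge0 ?IHk //; last 1 first.
- exact: leq_trans (card_lnk_lt e mD) _.
- exact: leq_trans (card_del_lt (matroid0 mL)) _.
exact: del_matroid.
Qed.

(** Deletion may create coloops and contributes only a nonnegative amount; contraction keeps
    coloop-freeness and carries the strict inequality. *)
Lemma tau_gt0 D : matroid D -> coloop_free D -> 0 < tau D.
Proof.
have [k] := ubnP #|D|; elim: k D => // k IHk D ltk mD cf.
have [/existsP[e eD]|/existsPn lD] := boolP [exists e, [set e] \in D]; last first.
  by rewrite (loopless_rank0 mD lD) tau_set0.
rewrite (tau_nonloop mD eD (cf e)) ltr_wpDl ?tau_ge0 //; first exact: del_matroid.
apply: IHk; [exact: leq_trans (card_lnk_lt e mD) _|exact: lnk_matroid|].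
exact: lnk_coloop_free.
Qed.

(** Contraction lowers the rank by one and stays cosimple, while cosimplicity makes the deletion
    coloop-free, so it contributes at least 1. *)
Lemma cosimple_rank D : matroid D -> coloop_free D -> cosimple D ->
  (complex_rank D)%:Z + 1 <= tau D.
Proof.
have [k] := ubnP #|D|; elim: k D => // k IHk D ltk mD cf cs.
have [/existsP[e eD]|/existsPn lD] := boolP [exists e, [set e] \in D]; last first.
  by rewrite (loopless_rank0 mD lD) tau_set0 rank_set0.
rewrite (tau_nonloop mD eD (cf e)) (rank_lnk mD eD).
have := tau_gt0 (del_matroid e mD) (cs e).
have : (complex_rank (lnk D e))%:Z + 1 <= tau (lnk D e).
  apply: IHk; [exact: leq_trans (card_lnk_lt e mD) _|exact: lnk_matroid| |].
    exact: lnk_coloop_free.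
  exact: lnk_cosimple.
lia.
Qed.

(** * Uniform matroids and the cosimple matroids with [tau] at most 3 *)

Definition uniform E k : {set {set 'I_n}} :=
  [set F : {set 'I_n} | (F \subset E) && (#|F| <= k)%N].

Lemma rank_uniform E k : (k <= #|E|)%N -> complex_rank (uniform E k) = k.
Proof.
move=> leE; have : (0 < #|[set A : {set 'I_n} | A \subset E & #|A| == k]|)%N.
  by rewrite cards_draws bin_gt0.
case/card_gt0P=> F; rewrite inE => /andP[sFE /eqP cF].
by rewrite (@rankE _ F) ?inE ?sFE ?cF ?leqnn // => G; rewrite inE => /andP[].
Qed.

Lemma tau_uniform1 E : (0 < #|E|)%N -> tau (uniform E 1) = #|E|%:Z - 1.
Proof.
move=> E0; rewrite /tau rank_uniform // (bigD1 set0) ?inE ?sub0set ?cards0 //=.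
rewrite expr1 addrC; congr (_ + _).
rewrite (eq_bigr (fun=> 1)) => [|F /andP[]]; last first.
  by rewrite inE => /andP[_ leF]; rewrite -card_gt0; case: #|F| leF => [|[]].
rewrite sumr_const natz; congr Posz.
rewrite -(card_imset (mem E) (@set1_inj _)); apply: eq_card => F.
rewrite unfold_in /= inE; apply/idP/imsetP=> [/andP[/andP[sFE leF] F0]|[e eE ->]].
  have /cards1P[e Fe] : #|F| == 1%N by rewrite eqn_leq leF card_gt0.
  by exists e => //; rewrite -sub1set -Fe.
by rewrite sub1set eE cards1 -card_gt0 cards1.
Qed.

Lemma matroid_rank1 D E : matroid D -> (forall F, F \in D -> F \subset E) ->
  (forall e, e \in E -> [set e] \in D) -> complex_rank D = 1%N -> D = uniform E 1.
Proof.
move=> mD DE loopless r1; apply/setP=> F; rewrite inE; apply/idP/andP=> [FD|[sFE]].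
  by rewrite DE // -r1 leq_rank.
case: (posnP #|F|) => [/eqP|F0 leF]; first by rewrite cards_eq0 => /eqP->; rewrite matroid0.
have /cards1P[e Fe] : #|F| == 1%N by rewrite eqn_leq leF.
by move: sFE; rewrite Fe sub1set => /loopless.
Qed.

(** The rank is at most 2. In rank 1 the matroid is U_{1,m} with [tau] equal to m - 1, which lies
    between 2 and 3. In rank 2 each contraction has [tau] at least 2 and each deletion at least 1,
    so these are exact; this excludes parallel pairs and then fixes [#|E|]. *)
Lemma cosimple_classification D E : matroid D -> (forall F, F \in D -> F \subset E) ->
  (forall e, e \in E -> [set e] \in D) -> coloop_free D -> cosimple D -> tau D <= 3 ->
  [\/ E = set0, D = uniform E 1 /\ (#|E| = 3 \/ #|E| = 4)%N
    | D = uniform E 2 /\ #|E| = 4%N].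
Proof.
move=> mD DE loopless cf cs tau3; have rk_tau := cosimple_rank mD cf cs.
have [->|[e0 e0E]] := set_0Vmem E; first by constructor 1.
have e0D := loopless _ e0E; have rkl := rank_lnk mD e0D.
have card_E : (0 < #|E|)%N by apply/card_gt0P; exists e0.
have [r1|r2] : complex_rank D = 1%N \/ complex_rank D = 2%N by lia.
  have DU := matroid_rank1 mD DE loopless r1.
  constructor 2; split=> //.
  by move: rk_tau tau3; rewrite r1 DU tau_uniform1 //; lia.
have tau_lnk e : e \in E -> 2 <= tau (lnk D e).
  move=> /loopless eD; have rl := rank_lnk mD eD.
  have := cosimple_rank (lnk_matroid mD eD) (lnk_coloop_free mD eD cf)
    (lnk_cosimple mD eD cf cs); lia.
have tau_del e : e \in E -> tau (del D e) = 1.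
  move=> eE; have := tau_lnk e eE; have := tau_nonloop mD (loopless _ eE) (cf e).
  have := tau_gt0 (del_matroid e mD) (cs e); lia.
(* If [e] and [f] were parallel, contracting [f] in [del D e] would give [lnk D f], whose [tau] is
   at least 2, whereas [tau (del D e)] is 1. *)
have pairs e f : e \in E -> f \in E -> [set e; f] \in D.
  have [<-|ef] := eqVneq e f; first by rewrite setUid => /loopless.
  move=> eE fE; apply: contraT => efD.
  have fDe : [set f] \in del D e by rewrite in_del loopless // inE.
  have := tau_nonloop (del_matroid e mD) fDe (cs e f).
  have := tau_ge0 (del_matroid f (del_matroid e mD)).
  have -> : lnk (del D e) f = lnk D f.
    rewrite -del_lnk ?[f == e]eq_sym //; apply/setP=> F; rewrite in_del in_lnk.
    case eF: (e \in F); rewrite ?andbT ?andbF //; apply/esym/negP=> /andP[_ fFD].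
    case/negP: efD; apply: matroidS mD fFD _.
    by rewrite subUset !sub1set !inE eqxx eF orbT.
  by have := tau_lnk f fE; rewrite tau_del //; lia.
constructor 3; split.
  apply/setP=> F; rewrite inE; apply/idP/andP=> [FD|[sFE]].
    by rewrite DE // -r2 leq_rank.
  case: (posnP #|F|) => [/eqP|F0 leF]; first by rewrite cards_eq0 => /eqP->; rewrite matroid0.
  have [/cards1P[e Fe]|c1] := boolP (#|F| == 1%N).
    by move: sFE; rewrite Fe sub1set => /loopless.
  have /cards2P[e [f [ef Fef]]] : #|F| == 2%N by move: c1; lia.
  by move: sFE; rewrite Fef subUset !sub1set => /andP[]; apply: pairs.
have lU : lnk D e0 = uniform (E :\ e0) 1.
  apply: matroid_rank1; first exact: lnk_matroid.
  - move=> F; rewrite in_lnk => /andP[eF /DE]; rewrite subUset subsetD1 eF andbT.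
    by case/andP.
  - move=> e /setD1P[ee0 eE]; rewrite in_lnk inE eq_sym ee0.
    exact: pairs.
  by move: rkl; rewrite r2 => -[<-].
have cE1 := cardsD1 e0 E; rewrite e0E in cE1.
have := tau_nonloop mD e0D (cf e0); have := tau_lnk e0 e0E; have := tau_del e0 e0E.
(* The formula for [tau] of U_{1,m} needs m > 0; the empty case is excluded because the contraction
   has rank 1. *)
rewrite lU; case: (posnP #|E :\ e0|) => [/cards0_eq c0|cgt]; last first.
  by rewrite tau_uniform1 //; lia.
have := rank_basis (matroid0 (lnk_matroid mD e0D)).
move: rkl; rewrite lU c0 r2 => -[<-] [B].
by rewrite inE subset0 => /andP[/eqP-> _]; rewrite cards0.
Qed.

End Minors.

(** * Pure order ideals *)

Section OrderIdeals.
Implicit Types (m s a b c d i j k : nat).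

Definition mcons m i (u : 'X_{1..m}) : 'X_{1..m.+1} :=
  [multinom if unlift ord0 j is Some l then u l else i | j < m.+1].
Definition mtail m (u : 'X_{1..m.+1}) : 'X_{1..m} :=
  [multinom u (lift ord0 j) | j < m].

Lemma mcons0 m i (u : 'X_{1..m}) : mcons i u ord0 = i.
Proof. by rewrite mnmE unlift_none. Qed.

Lemma mconsS m i (u : 'X_{1..m}) (j : 'I_m) : mcons i u (lift ord0 j) = u j.
Proof. by rewrite mnmE liftK. Qed.

Lemma mtailE m (u : 'X_{1..m.+1}) (j : 'I_m) : mtail u j = u (lift ord0 j).
Proof. by rewrite mnmE. Qed.

Lemma mconsK m i (u : 'X_{1..m}) : mtail (mcons i u) = u.
Proof. by apply/mnmP => j; rewrite mtailE mconsS. Qed.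

Lemma mcons_eta m (u : 'X_{1..m.+1}) : mcons (u ord0) (mtail u) = u.
Proof.
apply/mnmP => j; case: (unliftP ord0 j) => [l|] ->; last by rewrite mcons0.
by rewrite mconsS mtailE.
Qed.

Lemma mdeg_mcons m i (u : 'X_{1..m}) : mdeg (mcons i u) = (i + mdeg u)%N.
Proof.
by rewrite !mdegE big_ord_recl mcons0; congr addn; apply: eq_bigr => j _; rewrite mconsS.
Qed.

Lemma lem_mcons m i (u : 'X_{1..m}) j (v : 'X_{1..m}) :
  (i <= j)%N -> (u <= v)%MM -> (mcons i u <= mcons j v)%MM.
Proof.
move=> leij /mnm_lepP leuv; apply/mnm_lepP => k.
by case: (unliftP ord0 k) => [l|] ->; rewrite ?mcons0 ?mconsS.
Qed.

(** Purity in a form that survives adding a variable: every monomial divides one of degree [s],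
    which also bounds all degrees by [s]. *)
Definition pure_ideal m s (L : seq 'X_{1..m}) : Prop :=
  [/\ uniq L, 0%MM \in L, forall u v, (u <= v)%MM -> v \in L -> u \in L
    & forall u, u \in L -> exists2 v, v \in L & (u <= v)%MM /\ mdeg v = s].

Definition degree_poly m (L : seq 'X_{1..m}) : {poly int} :=
  \sum_(u <- L) 'X^(mdeg u).

(** An order ideal is a decreasing stack of slices along one variable; all the ideals below are
    built this way, one variable at a time. *)
Definition ladder m a (N : nat -> seq 'X_{1..m}) : seq 'X_{1..m.+1} :=
  [seq mcons i u | i <- iota 0 a, u <- N i].

Lemma mem_ladder m a (N : nat -> seq 'X_{1..m}) u :
  (u \in ladder a N) = (u ord0 < a)%N && (mtail u \in N (u ord0)).
Proof.
apply/allpairsPdep/andP => [[i [v [ia vN ->]]]|[ua uN]].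
  by rewrite mcons0 mconsK; rewrite mem_iota in ia.
by exists (u ord0), (mtail u); rewrite mem_iota mcons_eta.
Qed.

Lemma ladder_pure m a s (N : nat -> seq 'X_{1..m}) : (0 < a)%N ->
  (forall i, (i < a)%N -> exists t, pure_ideal t (N i)) ->
  (forall i j, (i <= j < a)%N -> {subset N j <= N i}) ->
  (forall i u, (i < a)%N -> u \in N i -> exists j v,
     [/\ (i <= j < a)%N, v \in N j, (u <= v)%MM & (j + mdeg v)%N = s]) ->
  pure_ideal s (ladder a N).
Proof.
move=> a_gt0 pN sN topN; split.
- apply: allpairs_uniq_dep; first exact: iota_uniq.
    by move=> i; rewrite mem_iota => /pN[t []].
  move=> [i u] [j v] _ _ /= e; have := congr1 (@mtail _) e; rewrite !mconsK => ->.
  by have := congr1 (fun w : 'X_{1.._} => w ord0) e; rewrite !mcons0 => ->.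
- rewrite mem_ladder mnm0E a_gt0; have [t [_ N0 _ _]] := pN _ a_gt0.
  by rewrite (_ : mtail _ = 0%MM) //; apply/mnmP=> j; rewrite mtailE !mnm0E.
- move=> u v /mnm_lepP leuv; rewrite !mem_ladder => /andP[va vN].
  have ua := leq_ltn_trans (leuv ord0) va; rewrite ua /=.
  have [t [_ _ dN _]] := pN _ ua; apply: (dN _ (mtail v)).
    by apply/mnm_lepP=> j; rewrite !mtailE.
  by apply: sN vN; rewrite leuv.
move=> u; rewrite mem_ladder => /andP[ua uN].
have [j [v [/andP[leij ja] vN leuv <-]]] := topN _ _ ua uN.
exists (mcons j v); first by rewrite mem_ladder mcons0 mconsK ja.
by rewrite mdeg_mcons -{1}[u]mcons_eta lem_mcons.
Qed.

Lemma degree_poly_ladder m a (N : nat -> seq 'X_{1..m}) :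
  degree_poly (ladder a N) = \sum_(i < a) 'X^i * degree_poly (N i).
Proof.
rewrite /degree_poly big_allpairs_dep -(subn0 a) -/(index_iota 0 a) subn0 big_mkord.
apply: eq_bigr => i _; rewrite mulr_sumr; apply: eq_bigr => u _.
by rewrite mdeg_mcons exprD.
Qed.

Definition geom a : {poly int} := \sum_(i < a) 'X^i.

Lemma geomE a : (1 - 'X) * geom a = 1 - 'X^a.
Proof.
rewrite -[in RHS](expr1n _ a) subrXX; congr (_ * _).
by apply: eq_bigr => i _; rewrite expr1n mul1r.
Qed.

Lemma geom_mulX a b p : 'X^a * geom b * p = \sum_(i < b) 'X^(a + i) * p.
Proof.
rewrite -mulrA [geom b * p]mulr_suml mulr_sumr.
by apply: eq_bigr => i _; rewrite exprD mulrA.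
Qed.

Definition two_steps m a b (N1 N2 : seq 'X_{1..m}) :=
  ladder (a + b) (fun i => if (i < a)%N then N1 else N2).

(** The last slice of the first block has exponent [a - 1] and the last slice of the second
    [a + b - 1]; the top degrees agree exactly when those of [N1] exceed those of [N2] by [b]. *)
Lemma two_steps_pure m a b s t (N1 N2 : seq 'X_{1..m}) : (0 < a)%N ->
  pure_ideal (t + b) N1 -> pure_ideal t N2 -> {subset N2 <= N1} ->
  s = (a.-1 + (t + b))%N -> pure_ideal s (two_steps a b N1 N2).
Proof.
move=> a_gt0 p1 p2 s21 ->; apply: ladder_pure; first lia.
- by move=> i _; case: ifP => _; [exists (t + b)%N|exists t].
- move=> i j /andP[leij jab]; case: ifP => ja; case: ifP => ia //.
  by move: ia; rewrite (leq_ltn_trans leij ja).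
move=> i u iab; case: ifP => ia uN.
  have [_ _ _ /(_ u uN)[v vN [leuv dv]]] := p1.
  exists a.-1, v; split; [lia| |by []|lia].
  by rewrite prednK // leqnn.
have [_ _ _ /(_ u uN)[v vN [leuv dv]]] := p2.
exists (a + b).-1, v; split; [lia| |by []|lia].
by rewrite ifF //; lia.
Qed.

Lemma degree_poly_two_steps m a b (N1 N2 : seq 'X_{1..m}) :
  degree_poly (two_steps a b N1 N2) =
    geom a * degree_poly N1 + 'X^a * geom b * degree_poly N2.
Proof.
rewrite degree_poly_ladder big_split_ord /=; congr (_ + _).
  by rewrite [RHS]mulr_suml; apply: eq_bigr => i _; rewrite ltn_ord.
by rewrite geom_mulX; apply: eq_bigr => i _; rewrite ltnNge leq_addr.
Qed.

Lemma sub_two_steps m a b b' (N1 N2 N1' N2' : seq 'X_{1..m}) :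
  {subset N1' <= N1} -> {subset N2' <= N2} -> (b' <= b)%N ->
  {subset two_steps a b' N1' N2' <= two_steps a b N1 N2}.
Proof.
move=> s1 s2 leb u; rewrite !mem_ladder => /andP[ltu uN].
apply/andP; split; first by lia.
by move: uN; case: ifP => _; [apply: s1|apply: s2].
Qed.

Definition interval k : seq 'X_{1..1} := two_steps k 0 [:: 0%MM] [:: 0%MM].

Lemma point_pure : pure_ideal 0 [:: 0%MM : 'X_{1..0}].
Proof.
split=> //; first by rewrite inE.
  by move=> u v _ _; rewrite inE nvar0_mnmE.
by move=> u; rewrite inE => /eqP->; exists 0%MM; rewrite ?inE ?mdeg0 ?lepm_refl.
Qed.

Lemma degree_poly_point : degree_poly [:: 0%MM : 'X_{1..0}] = 1.
Proof. by rewrite /degree_poly big_seq1 mdeg0. Qed.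

Lemma interval_pure s k : (0 < k)%N -> s = k.-1 -> pure_ideal s (interval k).
Proof.
move=> k0 ->; apply: (two_steps_pure (t := 0)) => //; try exact: point_pure.
by rewrite !addn0.
Qed.

Lemma degree_poly_interval k : degree_poly (interval k) = geom k.
Proof.
rewrite degree_poly_two_steps degree_poly_point [geom 0]big_ord0.
by rewrite mulr0 mul0r addr0 mulr1.
Qed.

Lemma sub_interval k l : (k <= l)%N -> {subset interval k <= interval l}.
Proof.
move=> lekl u; rewrite !mem_ladder !addn0 => /andP[uk]; rewrite uk => uN.
by rewrite (leq_trans uk lekl).
Qed.

Definition pure_degree_poly (p : {poly int}) : Prop :=
  exists m s (L : seq 'X_{1..m}), pure_ideal s L /\ degree_poly L = p.

Lemma pure_degree_poly1 : pure_degree_poly 1.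
Proof.
by exists 0%N, 0%N, [:: 0%MM]; split; [exact: point_pure|exact: degree_poly_point].
Qed.

Lemma pure_degree_poly_geom a p : (0 < a)%N ->
  pure_degree_poly p -> pure_degree_poly (geom a * p).
Proof.
move=> a0 [m [s [L [pL <-]]]]; exists m.+1, (a.-1 + s)%N, (two_steps a 0 L L); split.
  by apply: (two_steps_pure (t := s)) => //; rewrite addn0.
by rewrite degree_poly_two_steps [geom 0]big_ord0 mulr0 mul0r addr0.
Qed.

(** The maximal monomials are x^(a-1) y^(b+c-1) and x^(a+b-1) y^(c-1): an a by c box, lengthened by
    [b] in either direction. *)
Lemma pure_triangle a b c : (0 < a)%N -> (0 < b)%N -> (0 < c)%N ->
  pure_degree_poly (geom a * geom (b + c) + 'X^a * geom b * geom c).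
Proof.
move=> a0 b0 c0; exists 2, (a.-1 + (c.-1 + b))%N.
exists (two_steps a b (interval (b + c)) (interval c)); split.
  apply: (two_steps_pure (t := c.-1)) => //; try by apply: interval_pure; lia.
  by apply: sub_interval; lia.
by rewrite degree_poly_two_steps !degree_poly_interval.
Qed.

(** An a by c by d box lengthened by [b] in one of three directions. The third maximal monomial,
    x^(a+b-1) y^(c-1) z^(d-1), comes from the second outer block. *)
Lemma pure_star a b c d : (0 < a)%N -> (0 < b)%N -> (0 < c)%N -> (0 < d)%N ->
  pure_degree_poly
    (geom a * (geom c * geom (b + d) + 'X^c * geom b * geom d)
      + 'X^a * geom b * (geom c * geom d)).
Proof.
move=> a0 b0 c0 d0; exists 3, (a.-1 + ((c.-1 + d.-1) + b))%N.
exists (two_steps a b (two_steps c b (interval (b + d)) (interval d))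
          (two_steps c 0 (interval d) (interval d))); split; last first.
  rewrite degree_poly_two_steps (degree_poly_two_steps c b) (degree_poly_two_steps c 0).
  by rewrite !degree_poly_interval [geom 0]big_ord0 mulr0 mul0r addr0.
have sI : {subset interval d <= interval (b + d)} by apply: sub_interval; lia.
apply: (two_steps_pure (t := (c.-1 + d.-1)%N)) => //.
- by apply: (two_steps_pure (t := d.-1)); rewrite ?addnA //; apply: interval_pure; lia.
- by apply: (two_steps_pure (t := d.-1)); rewrite ?addn0 //; apply: interval_pure; lia.
exact: sub_two_steps.
Qed.

(** The maximal monomials are x^(a-1) y^(b+c+d-1), x^(a+b-1) y^(c+d-1) and x^(a+b+c-1) y^(d-1), all
    of degree a+b+c+d-2. *)
Lemma pure_staircase a b c d : (0 < a)%N -> (0 < b)%N -> (0 < c)%N -> (0 < d)%N ->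
  pure_degree_poly
    (geom a * geom (b + c + d) + 'X^a * geom b * geom (c + d)
      + 'X^(a + b) * geom c * geom d).
Proof.
move=> a0 b0 c0 d0.
(* [w i] is the height of column [i]; below, [j] is the last column of the same height, where the
   corner of degree [s] sits. *)
pose w i := (if (i < a)%N then b + c + d else if (i < a + b)%N then c + d else d)%N.
have w0 i : (0 < w i)%N by rewrite /w; repeat case: ifP => ?; lia.
exists 2, (a + b + c + d).-2, (ladder (a + b + c) (interval \o w)); split.
  apply: ladder_pure; first lia.
  - by move=> i _; exists (w i).-1; apply: interval_pure.
  - move=> i j /andP[leij _]; apply: sub_interval; rewrite /w.
    by repeat case: ifP => ?; lia.
  move=> i u iabc /= ui.
  have [_ _ _ /(_ u ui)[v vi [leuv dv]]] := interval_pure (w0 i) erefl.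
  pose j := (if (i < a)%N then a.-1 else if (i < a + b)%N then (a + b).-1
             else (a + b + c).-1)%N.
  have [wj ij js] : [/\ w j = w i, (i <= j < a + b + c)%N
                      & (j + (w i).-1 = (a + b + c + d).-2)%N].
    rewrite /w /j; case: (ltnP i a) => ?; last case: (ltnP i (a + b)) => ?;
    by split; repeat case: ifP => ?; lia.
  by exists j, v; rewrite wj dv.
rewrite degree_poly_ladder !big_split_ord /= !geom_mulX.
congr (_ + _ + _).
- rewrite [RHS]mulr_suml; apply: eq_bigr => i _.
  by rewrite degree_poly_interval /w ltn_ord.
- apply: eq_bigr => i _.
  by rewrite degree_poly_interval /w ltnNge leq_addr /= ltn_add2l ltn_ord.
by apply: eq_bigr => i _; rewrite degree_poly_interval /w !ifF //; lia.
Qed.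

Lemma coef_degree_poly m (L : seq 'X_{1..m}) i :
  (degree_poly L)`_i = (count (fun u => mdeg u == i) L)%:Z.
Proof.
rewrite coef_sum -natz -sum1_count [in RHS]natr_sum [in RHS]big_mkcond.
by apply: eq_bigr => u _; rewrite coefXn eq_sym; case: eqP.
Qed.

Lemma pure_degree_polyP (h : seq int) : last 0 h != 0 ->
  pure_degree_poly (Poly h) -> pure_O_sequence h.
Proof.
move=> h_last [m [s [L [[uL L0 dL topL] /esym hL]]]].
exists m, [fset u in L]%fset.
have ML u : (u \in [fset u in L]%fset) = (u \in L) by rewrite inE.
have le_s u : u \in L -> (mdeg u <= s)%N.
  by move=> /topL[v _ [/mnm_lepP leuv <-]]; rewrite !mdegE leq_sum.
have [v0 v0L [_ dv0]] := topL _ L0.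
have max_s : (\max_(u <- [fset u in L]%fset) mdeg u = s)%N.
  apply/eqP; rewrite eqn_leq; apply/andP; split.
    by apply/bigmax_leqP_seq => u; rewrite ML => /le_s.
  by rewrite -dv0; apply: (leq_bigmax_seq (F := @mdeg m)); rewrite ?ML.
split.
- by apply/fset0Pn; exists 0%MM; rewrite ML.
- by move=> u v leuv; rewrite !ML; apply: dL.
- suff top u : maximal_monomial [fset u in L]%fset u -> mdeg u = s.
    by move=> u v /top-> /top->.
  case; rewrite ML => /topL[v vL [leuv <-]] maxu.
  by rewrite (maxu v) ?ML.
(* The nonzero last entry rules out trailing zeros in [h], so its length is read off from the top
   degree [s], attained by [v0]. *)
have size_h : size h = s.+1.
  have hK : polyseq (Poly h) = h by rewrite (PolyK h_last).
  apply/eqP; rewrite eqn_leq -{1}hK hL; apply/andP; split.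
    apply/leq_sizeP => j ltj; rewrite coef_degree_poly (_ : count _ _ = 0%N) //.
    apply/eqP; rewrite -leqn0 leqNgt -has_count; apply/hasPn => u /le_s.
    by apply: contraL => /eqP->; rewrite -ltnNge.
  rewrite ltnNge; apply/negP => /(nth_default 0); rewrite -[h]hK hL coef_degree_poly => /eqP.
  by rewrite eqz_nat -leqn0 leqNgt -has_count; case/hasP; exists v0; rewrite ?dv0.
apply: (@eq_from_nth _ 0); first by rewrite !size_map size_iota max_s.
move=> i ltih; rewrite (nth_map 0%N) ?size_mkseq ?max_s -?size_h //.
rewrite nth_mkseq ?max_s -?size_h //.
rewrite -[LHS]coef_Poly hL coef_degree_poly -size_filter; congr Posz.
rewrite (_ : [fset _ in _ | _]%fset = [fset u in [seq u <- L | mdeg u == i]]%fset).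
  by rewrite card_fseq undup_id // filter_uniq.
by apply/fsetP=> u; rewrite !inE mem_filter andbC.
Qed.

End OrderIdeals.

(** * Numerators of Hilbert series *)

Section HilbertNumerator.
Variable n : nat.
Implicit Types (D : {set {set 'I_n}}) (E F G H : {set 'I_n}) (e f : 'I_n).
Implicit Types (a : 'I_n -> nat).

(* For constant weight 1 this is (1 - t)^#|E| times the Hilbert series of D over
   the ground set E. In general it describes D with each e replaced by a series
   class of size a e. *)
Definition numerator D E a : {poly int} :=
  \sum_(F in D) (\prod_(i in F) 'X^(a i)) * \prod_(i in E :\: F) (1 - 'X^(a i)).

Lemma numerator_del_lnk D E a e : e \in E ->
  (forall F, F \in D -> F \subset E) ->
  numerator D E a = (1 - 'X^(a e)) * numerator (del D e) (E :\ e) a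
    + 'X^(a e) * numerator (lnk D e) (E :\ e) a.
Proof.
move=> eE DE; rewrite /numerator (sum_del_lnk _ _ e) !mulr_sumr; congr (_ + _).
  apply: eq_bigr => F; rewrite in_del => /andP[_ eF].
  rewrite mulrCA; congr (_ * _); rewrite (bigD1 e) /=; last by rewrite inE eF.
  by congr (_ * _); apply: eq_bigl => i; rewrite !inE -andbA [X in _ && X]andbC.
apply: eq_bigr => F; rewrite in_lnk => /andP[eF _].
rewrite (bigD1 e) /=; last by rewrite !inE eqxx.
rewrite mulrA; congr (_ * _ * _); apply: eq_bigl => i.
  by rewrite !inE; case: eqVneq => [->|_] //=; rewrite ?(negPf eF) ?andbT.
by rewrite !inE negb_or -andbA andbCA.
Qed.

Lemma numerator_loop D E a e : e \in E ->
  (forall F, F \in D -> F \subset E :\ e) ->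
  numerator D E a = (1 - 'X^(a e)) * numerator D (E :\ e) a.
Proof.
move=> eE DE; have eF F : F \in D -> e \notin F.
  by move/DE/subsetP/(_ e); rewrite !inE eqxx /=; case: (e \in F) => // /(_ isT).
rewrite (@numerator_del_lnk _ _ _ e) // => [|F /DE]; last by rewrite subsetD1 => /andP[].
rewrite [X in _ + _ * X]big1 ?mulr0 ?addr0 => [|F]; last first.
  by rewrite in_lnk => /andP[_ /eF]; rewrite !inE eqxx.
congr (_ * numerator _ _ _); apply/setP=> F; rewrite in_del.
by case FD: (F \in D); rewrite //= eF.
Qed.

Lemma numerator_coloop D E a e : matroid D -> coloop D e -> e \in E ->
  (forall F, F \in D -> F \subset E) ->
  numerator D E a = numerator (lnk D e) (E :\ e) a.
Proof.
move=> mD cl eE DE; rewrite (numerator_del_lnk _ eE DE) coloop_del_lnk //.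
by rewrite -mulrDl subrK mul1r.
Qed.

Lemma eq_numerator D E a a' : (forall F, F \in D -> F \subset E) ->
  {in E, a =1 a'} -> numerator D E a = numerator D E a'.
Proof.
move=> DE eqa; apply: eq_bigr => F /DE/subsetP sFE; congr (_ * _).
  by apply: eq_bigr => i /sFE/eqa->.
by apply: eq_bigr => i /setDP[/eqa->].
Qed.

Lemma lnk_sub D E e : (forall F, F \in D -> F \subset E) ->
  forall F, F \in lnk D e -> F \subset E :\ e.
Proof.
move=> DE F; rewrite in_lnk subsetD1 => /andP[-> /DE].
by rewrite subUset andbT => /andP[].
Qed.

Lemma del_sub D E e : (forall F, F \in D -> F \subset E) ->
  forall F, F \in del D e -> F \subset E :\ e.
Proof. by move=> DE F; rewrite in_del subsetD1 => /andP[/DE-> ->]. Qed.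

(** Split at [e], then at [f]. In [del D e] the element [f] is a coloop, and contracting it gives
    the same matroid as [del (lnk D e) f]. The common term gets the coefficient (1 - A) + A (1 - B)
    = 1 - AB, where A and B are the powers of t for [e] and [f]: a single element of weight
    [a e + a f]. *)
Lemma numerator_series D E a e f : matroid D -> (forall F, F \in D -> F \subset E) ->
  e \in E -> f \in E -> ~~ coloop D e -> coloop (del D f) e ->
  numerator D E a =
  numerator (lnk D e) (E :\ e) (fun i => if i == f then (a e + a f)%N else a i).
Proof.
move=> mD DE eE fE ncl cl; have cl' := coloop_delC mD ncl cl.
have [mDe mDf] := (del_matroid e mD, del_matroid f mD).
have fe : f != e.
  by have := coloop1 mDf cl; rewrite in_del !inE => /andP[].
have fEe : f \in E :\ e by rewrite !inE fe.
have [De Le] := (del_sub (e := e) DE, lnk_sub (e := e) DE).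
rewrite (numerator_del_lnk _ eE DE) (numerator_coloop _ mDe cl' fEe De).
rewrite -coloop_del_lnk // delC (coloop_del_lnk mDf cl) -del_lnk 1?eq_sym //.
rewrite !(numerator_del_lnk _ fEe Le) eqxx exprD.
have eqa : {in E :\ e :\ f, a =1 (fun i => if i == f then (a e + a f)%N else a i)}.
  by move=> i; rewrite !inE => /andP[/negPf->].
rewrite -(eq_numerator (del_sub Le) eqa) -(eq_numerator (lnk_sub Le) eqa).
by ring.
Qed.

Lemma coloop_lnk_trace D E e F : matroid D -> coloop D e -> e \in E ->
  (F :&: (E :\ e) \in lnk D e) = (F :&: E \in D).
Proof.
move=> mD /coloopP cl eE; rewrite in_lnk !inE eqxx andbF /=.
apply/idP/idP => [/(matroidS mD)|/cl]; first apply.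
  by apply/subsetP => i; rewrite !inE; case: eqVneq.
rewrite (_ : e |: (F :&: (E :\ e)) = e |: (F :&: E)) //.
by apply/setP => i; rewrite !inE; case: eqVneq.
Qed.

(** The three final clauses preserve what is compared later: the corank, the numerator, and the set
    of monomials spanning the Stanley-Reisner ideal. *)
Lemma contract_coloops D E : matroid D -> (forall F, F \in D -> F \subset E) ->
  exists D' E', [/\ matroid D', forall F, F \in D' -> F \subset E' & coloop_free D'] /\
    [/\ (#|E'| - complex_rank D' = #|E| - complex_rank D)%N,
        forall a, numerator D' E' a = numerator D E a
      & forall F, (F :&: E' \in D') = (F :&: E \in D)].
Proof.
have [N] := ubnP #|E|; elim: N D E => // N IHN D E ltN mD DE.
have [/existsP[e cl]|/existsPn cf] := boolP [exists e, coloop D e]; last by exists D, E.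
have eD := coloop1 mD cl.
have eE : e \in E by rewrite -sub1set DE.
have cE : #|E| = #|E :\ e|.+1 by rewrite (cardsD1 e) eE.
have [|D' [E' [? [rk' num' trace']]]] := IHN _ _ _ (lnk_matroid mD eD) (lnk_sub DE).
  by rewrite cE in ltN.
exists D', E'; split=> //; split=> [|a|F]; first by rewrite rk' cE (rank_lnk mD eD).
  by rewrite num' -numerator_coloop.
by rewrite trace' coloop_lnk_trace.
Qed.

(** Deletion-contraction of the first element of a uniform matroid; for [k = 0] it is a loop and the
    contraction term disappears. *)
Fixpoint uniform_numerator (s : seq nat) k : {poly int} :=
  if s is a :: s' then
    (1 - 'X^a) * uniform_numerator s' k
    + (if k is k'.+1 then 'X^a * uniform_numerator s' k' else 0)
  else 1.

Lemma numerator_uniform (s : seq 'I_n) k a : uniq s ->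
  numerator (uniform [set:: s] k) [set:: s] a = uniform_numerator (map a s) k.
Proof.
elim: s k => [|e s IHs] k /=.
  move=> _; have -> : uniform [set:: [::]] k = [set set0 : {set 'I_n}].
    apply/setP=> F; rewrite !inE set_nil subset0.
    by case: eqP => // ->; rewrite cards0.
  by rewrite /numerator big_set1 set_nil setD0 !big_set0 mulr1.
move=> /andP[es us]; have eE : e \in [set:: e :: s] by rewrite !inE eqxx.
rewrite (@numerator_del_lnk _ _ _ e) //; last by move=> F; rewrite inE => /andP[].
have Ee : [set:: e :: s] :\ e = [set:: s].
  apply/setP=> i; rewrite !inE; case: eqVneq => [->|] //=; by rewrite (negPf es).
have dE : del (uniform [set:: e :: s] k) e = uniform [set:: s] k.
  by apply/setP=> F; rewrite in_del !(in_set (fun _ => _ && _)) -Ee subsetD1 andbAC.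
have lE : lnk (uniform [set:: e :: s] k) e
    = if k is k'.+1 then uniform [set:: s] k' else set0.
  apply/setP=> F; rewrite in_lnk inE subUset sub1set eE /=.
  case: (boolP (e \in F)) => eF /=.
    by case: k {dE} => [|k]; rewrite !inE // -Ee subsetD1 eF andbF.
  rewrite cardsU1 eF; case: k {dE} => [|k]; rewrite !inE ?andbF //.
  by rewrite -Ee subsetD1 eF andbT.
rewrite dE lE Ee IHs //; case: k {dE lE} => [|k]; last by rewrite IHs.
by rewrite /numerator big_set0 mulr0.
Qed.

Lemma numerator_uniform_enum E k a :
  numerator (uniform E k) E a = uniform_numerator (map a (enum E)) k.
Proof. by rewrite -numerator_uniform ?enum_uniq ?set_enum. Qed.

(** Each [geom] absorbs one factor 1 - t, and powers of t become independent symbols, leaving a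
    polynomial identity for [ring]. The next two lemmas work alike. *)
Lemma triangle_numerator (a b c : nat) : uniform_numerator [:: a; b; c] 1 =
  (1 - 'X) ^+ 2 * (geom a * geom (b + c) + 'X^a * geom b * geom c).
Proof.
move: (geomE a) (geomE b) (geomE c) (geomE (b + c)); rewrite exprD /=.
move: (geom a) (geom b) (geom c) (geom (b + c)) ('X^a) ('X^b) ('X^c) => ga gb gc gbc A B C.
move=> Ea Eb Ec Ebc.
have -> : (1 - 'X) ^+ 2 * (ga * gbc + A * gb * gc)
    = ((1 - 'X) * ga) * ((1 - 'X) * gbc) + A * ((1 - 'X) * gb) * ((1 - 'X) * gc).
  by ring.
by rewrite Ea Eb Ec Ebc; ring.
Qed.

Lemma star_numerator (a b c d : nat) : uniform_numerator [:: a; b; c; d] 1 =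
  (1 - 'X) ^+ 3 * (geom a * (geom c * geom (b + d) + 'X^c * geom b * geom d)
      + 'X^a * geom b * (geom c * geom d)).
Proof.
move: (geomE a) (geomE b) (geomE c) (geomE d) (geomE (b + d)); rewrite exprD /=.
move: (geom a) (geom b) (geom c) (geom d) (geom (b + d)) => ga gb gc gd gbd.
move: ('X^a) ('X^b) ('X^c) ('X^d) => A B C D Ea Eb Ec Ed Ebd.
have -> : (1 - 'X) ^+ 3 * (ga * (gc * gbd + C * gb * gd) + A * gb * (gc * gd))
    = ((1 - 'X) * ga) * (((1 - 'X) * gc) * ((1 - 'X) * gbd)
      + C * ((1 - 'X) * gb) * ((1 - 'X) * gd))
    + A * ((1 - 'X) * gb) * (((1 - 'X) * gc) * ((1 - 'X) * gd)).
  by ring.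
by rewrite Ea Eb Ec Ed Ebd; ring.
Qed.

Lemma staircase_numerator (a b c d : nat) : uniform_numerator [:: a; b; c; d] 2 =
  (1 - 'X) ^+ 2 * (geom a * geom (b + c + d) + 'X^a * geom b * geom (c + d)
      + 'X^(a + b) * geom c * geom d).
Proof.
move: (geomE a) (geomE b) (geomE c) (geomE d) (geomE (b + c + d)) (geomE (c + d)).
rewrite !exprD /=.
move: (geom a) (geom b) (geom c) (geom d) (geom (b + c + d)) (geom (c + d)).
move=> ga gb gc gd gbcd gcd.
move: ('X^a) ('X^b) ('X^c) ('X^d) => A B C D Ea Eb Ec Ed Ebcd Ecd.
have -> : (1 - 'X) ^+ 2 * (ga * gbcd + A * gb * gcd + A * B * gc * gd)
    = ((1 - 'X) * ga) * ((1 - 'X) * gbcd) + A * ((1 - 'X) * gb) * ((1 - 'X) * gcd)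
    + A * B * ((1 - 'X) * gc) * ((1 - 'X) * gd).
  by ring.
by rewrite Ea Eb Ec Ed Ebcd Ecd; ring.
Qed.

Lemma matroid_numerator D E a : matroid D -> (forall F, F \in D -> F \subset E) ->
  (forall i, (0 < a i)%N) -> coloop_free D -> tau D <= 3 ->
  exists2 p, pure_degree_poly p
    & numerator D E a = (1 - 'X) ^+ (#|E| - complex_rank D) * p.
Proof.
have [N] := ubnP #|E|; elim: N D E a => // N IHN D E a leN mD DE a_gt0 cf tau3.
have leN' e : e \in E -> (#|E :\ e| < N)%N by move=> eE; rewrite (cardsD1 e) eE in leN.
have rkE : (complex_rank D <= #|E|)%N by apply/bigmax_leqP => F /DE/subset_leq_card.
have [/existsP[e /andP[eE eD]]|/existsPn noloop] :=
  boolP [exists e, (e \in E) && ([set e] \notin D)].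
  have DEe F : F \in D -> F \subset E :\ e.
    move=> FD; rewrite subsetD1 DE //=; apply: contraNN eD => eF.
    by apply: matroidS mD FD _; rewrite sub1set.
  have [p pp KE] := IHN _ _ a (leN' e eE) mD DEe a_gt0 cf tau3.
  exists (geom (a e) * p); first exact: pure_degree_poly_geom.
  rewrite (numerator_loop _ eE DEe) KE -geomE.
  have rkEe : (complex_rank D <= #|E :\ e|)%N.
    by apply/bigmax_leqP => F /DEe/subset_leq_card.
  by rewrite (cardsD1 e E) eE add1n subSn // exprS mulrACA.
have loopless e : e \in E -> [set e] \in D.
  by have := noloop e; case: (e \in E); rewrite //= negbK.
have [/existsP[f /existsP[e cl]]|/existsPn nocl] :=
  boolP [exists f, [exists e, coloop (del D f) e]].
  have mDf := del_matroid f mD.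
  have /[!in_del] /andP[eD fe] := coloop1 mDf cl.
  have eE : e \in E by rewrite -sub1set DE.
  (* Outside [E] deletion changes nothing, and [e] would be a coloop of [D] itself. *)
  have fE : f \in E.
    apply: contraT => fE; have := cf e; rewrite (_ : D = del D f) ?cl //.
    apply/setP=> F; rewrite in_del; case FD: (F \in D) => //=.
    by rewrite (contraNN (subsetP (DE _ FD) f)).
  rewrite (numerator_series a mD DE eE fE (cf e) cl).
  have mL := lnk_matroid mD eD.
  (* The deletion of [e] has the coloop [f], so its [tau] vanishes and the bound passes to the
     contraction. *)
  have tauL : tau (lnk D e) = tau D.
    rewrite (tau_nonloop mD eD (cf e)).
    by rewrite (tau_coloop (del_matroid e mD) (coloop_delC mD (cf e) cl)) add0r.
  have [| | |i| | |p pp ->] :=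
    IHN (lnk D e) (E :\ e) (fun i => if i == f then (a e + a f)%N else a i).
  - exact: leN'.
  - exact: mL.
  - exact: lnk_sub.
  - by case: ifP => // _; rewrite addn_gt0 a_gt0.
  - exact: lnk_coloop_free.
  - by rewrite tauL.
  (* Rank and ground set both lose one, so the power of 1 - t is unchanged. *)
  exists p => //; congr (_ ^+ _ * _).
  by rewrite (rank_lnk mD eD) (cardsD1 e E) eE.
have cs : cosimple D by move=> f e; have /existsPn := nocl f; apply.
have [E0|[DU cE]|[DU cE]] := cosimple_classification mD DE loopless cf cs tau3.
- exists 1; first exact: pure_degree_poly1.
  have D0 : D = [set set0].
    apply/setP=> F; rewrite inE; apply/idP/eqP => [/DE|->]; last exact: matroid0.
    by rewrite E0 subset0 => /eqP.
  by rewrite D0 E0 rank_set0 cards0 /numerator big_set1 setD0 !big_set0.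
- have rU : complex_rank D = 1%N by rewrite DU rank_uniform //; lia.
  rewrite rU DU numerator_uniform_enum.
  case: cE => cE; rewrite cE; move: cE; rewrite cardE.
    case: (enum E) => [|x [|y [|z [|]]]] // _; rewrite triangle_numerator.
    by eexists; first exact: (pure_triangle (a_gt0 x) (a_gt0 y) (a_gt0 z)).
  case: (enum E) => [|x [|y [|z [|t [|]]]]] // _; rewrite star_numerator.
  by eexists; first exact: (pure_star (a_gt0 x) (a_gt0 y) (a_gt0 z) (a_gt0 t)).
rewrite cE DU rank_uniform ?cE // numerator_uniform_enum; move: cE; rewrite cardE.
case: (enum E) => [|x [|y [|z [|t [|]]]]] // _; rewrite staircase_numerator.
by eexists; first exact: (pure_staircase (a_gt0 x) (a_gt0 y) (a_gt0 z) (a_gt0 t)).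
Qed.

End HilbertNumerator.

(** * The h-vector *)

Section CoefficientsBelow.
Implicit Types (p q : {poly int}) (N : nat).

(** Congruence modulo ['X^N]: Hilbert series are handled as truncated polynomials. *)
Definition agree_below N p q := forall i, (i < N)%N -> p`_i = q`_i.

Lemma agree_belowM N p p' q q' : agree_below N p p' -> agree_below N q q' ->
  agree_below N (p * q) (p' * q').
Proof.
move=> Hp Hq i ltiN; rewrite !coefM; apply: eq_bigr => -[j /= ltj] _.
by rewrite Hp ?Hq //; lia.
Qed.

Lemma agree_below_prod N (I : finType) (A : {pred I}) (P Q : I -> {poly int}) :
  (forall i, agree_below N (P i) (Q i)) ->
  agree_below N (\prod_(i in A) P i) (\prod_(i in A) Q i).
Proof.
by move=> PQ; elim/big_ind2: _ => // *; apply: agree_belowM.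
Qed.

Lemma agree_below_sum N (I : finType) (A : {pred I}) (P Q : I -> {poly int}) :
  (forall i, agree_below N (P i) (Q i)) ->
  agree_below N (\sum_(i in A) P i) (\sum_(i in A) Q i).
Proof.
by move=> PQ j ltj; rewrite !coef_sum; apply: eq_bigr => i _; apply: PQ.
Qed.

End CoefficientsBelow.

Section HilbertFunction.
Variables (k : fieldType) (n : nat).
Implicit Types (D : {set {set 'I_n}}) (E F G : {set 'I_n}) (m : 'X_{1..n}).
Implicit Types (p q : {mpoly k[n]}).

Definition supp m : {set 'I_n} := [set i | (0 < m i)%N].

(** A monomial ideal given by its monomials rather than by generators. Exponents outside [E] are
    ignored, so the ideals of all minors lie in one ring. *)
Definition SR_ideal_on D E p := forall m, m \in msupp p -> supp m :&: E \notin D.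

Lemma suppD m1 m2 : supp (m1 + m2)%MM = supp m1 :|: supp m2.
Proof. by apply/setP => i; rewrite !inE mnmDE addn_gt0. Qed.

Lemma supp_sum F : supp (\big[mnm_add/0%MM]_(i in F) U_(i)%MM) = F.
Proof.
apply/setP => i; rewrite inE mnm_sumE; apply/idP/idP => [|iF].
  apply: contraTT => iF; rewrite -leqNgt leqn0 sum_nat_eq0.
  by apply/forall_inP => j jF; rewrite mnm1E; case: (j =P i) jF iF => // -> ->.
by rewrite (bigD1 i) //= mnm1E eqxx.
Qed.

Lemma SR_idealP D : simplicial_complex D ->
  forall p, SR_ideal D p <-> SR_ideal_on D setT p.
Proof.
move=> [_ DS] p; split.
  case=> c -> m /msupp_sum_le/flattenP[s /mapP[F]].
  rewrite mem_filter => /andP[FD _] ->.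
  rewrite mprodXE => /msuppM_le/allpairsP[[m1 m2] /= [_ + ->]].
  move/mem_msuppXP => <-; rewrite setIT suppD supp_sum.
  by apply: contraNN FD => FD; apply: DS FD (subsetUr _ _).
move=> Hp; pose u (F : {set 'I_n}) := (\big[mnm_add/0%MM]_(i in F) U_(i)%MM).
(* Each term of [p] is charged to a single nonface, its own support. *)
exists (fun F => \sum_(m <- msupp p | supp m == F) p@_m *: 'X_[m - u F]).
under eq_bigr do rewrite mprodXE mulr_suml.
rewrite (exchange_big_dep predT) //= {1}[p]mpolyE big_seq [RHS]big_seq.
apply: eq_bigr => m mp; rewrite (big_pred1 (supp m)) => [|F /=].
  rewrite -scalerAl -mpolyXD submK //; apply/mnm_lepP => i.
  have := supp_sum (supp m) => /setP/(_ i); rewrite !inE /u mnm_sumE.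
  case: (posnP (m i)) => [-> /negbT|mi _]; first by rewrite -leqNgt.
  rewrite (bigD1 i) ?inE //= mnm1E eqxx big1 // => j /andP[_ /negPf].
  by rewrite mnm1E => ->.
have := Hp m mp; rewrite setIT; case: (eqVneq (supp m) F) => [-> -> //|_ _].
by rewrite andbF.
Qed.

Definition monomial_of N (f : {ffun 'I_n -> 'I_N}) : 'X_{1..n} :=
  [multinom f i : nat | i < n].

Definition face_monomials D N d : {set {ffun 'I_n -> 'I_N}} :=
  [set f | (supp (monomial_of f) \in D) && (mdeg (monomial_of f) == d)].

Lemma monomial_of_inj N : injective (@monomial_of N).
Proof.
move=> f g /mnmP efg; apply/ffunP=> i; apply: val_inj.
by have := efg i; rewrite !mnmE.
Qed.

Lemma monomial_of_surj N m : (mdeg m < N)%N -> exists f, @monomial_of N f = m.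
Proof.
move=> ltN; have lti i : (m i < N)%N.
  by apply: leq_ltn_trans ltN; rewrite mdegE (bigD1 i) //= leq_addr.
exists [ffun i => Ordinal (lti i)]; apply/mnmP => i.
by rewrite mnmE ffunE.
Qed.

(** The coefficients of the given basis on the face monomials form a matrix that is row free, by
    independence modulo the ideal, and row full, since each face monomial is spanned; hence it is
    square. *)
Lemma quotient_dim_card D N d M : simplicial_complex D -> (d < N)%N ->
  quotient_dim (@SR_ideal k n D) d M -> M = #|face_monomials D N d|.
Proof.
move=> scD ltdN [b [hom_b free_b span_b]].
have SRP := SR_idealP scD.
pose mon (t : 'I_#|face_monomials D N d|) := monomial_of (enum_val t).
have monP t : (supp (mon t) \in D) && (mdeg (mon t) == d).
  by have := enum_valP t; rewrite inE.
have mon_surj m : supp m \in D -> mdeg m = d -> exists t, mon t = m.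
  move=> mD md; have [|f fm] := @monomial_of_surj N m; first by rewrite md.
  have fF : f \in face_monomials D N d by rewrite inE fm mD md eqxx.
  by exists (enum_rank_in fF f); rewrite /mon enum_rankK_in.
pose B : 'M[k]_(M, #|face_monomials D N d|) := \matrix_(j, t) (b j)@_(mon t).
have coefB (c : 'I_M -> k) t : (\sum_j c j *: b j)@_(mon t) = ((\row_j c j) *m B) 0 t.
  by rewrite raddf_sum mxE /=; apply: eq_bigr => j _; rewrite mcoeffZ !mxE.
have freeB : row_free B.
  rewrite -kermx_eq0; apply/rowV0P => v /sub_kermxP vB0; apply/rowP => j.
  rewrite mxE; apply: (free_b (fun j => v 0 j)); apply/SRP => m; rewrite setIT.
  rewrite mcoeff_msupp; apply: contraNN => mD; apply/eqP.
  have [md|/eqP md] := eqVneq (mdeg m) d; last first.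
    rewrite (@dhomog_nemf_coeff _ _ mdeg d) //; last exact/eqP.
    by apply: rpred_sum => i _; apply: rpredZ.
  have [t <-] := mon_surj m mD md; rewrite coefB.
  have -> : \row_j0 v 0 j0 = v by apply/rowP => i; rewrite mxE.
  by rewrite vB0 mxE.
have fullB : row_full B.
  have /fin_all_exists[c cP] t : exists c : 'I_M -> k,
      (\row_j c j) *m B = delta_mx 0 t.
    have /andP[_ /eqP mont_d] := monP t.
    have [|c /SRP cP] := span_b 'X_[mon t]; first by rewrite dhomogX; apply/eqP.
    exists c; apply/rowP => t'; rewrite -coefB.
    have : 'X_[mon t]@_(mon t') - (\sum_j c j *: b j)@_(mon t') = 0.
      rewrite -mcoeffB; apply: memN_msupp_eq0; apply: contraTN (monP t') => /cP.
      by rewrite setIT negb_and => ->.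
    move/eqP; rewrite subr_eq0 => /eqP <-; rewrite mcoeffX mxE eqxx /=.
    congr (_%:R); congr nat_of_bool; apply/eqP/eqP => [|->] //.
    by move/monomial_of_inj/enum_val_inj.
  apply/row_fullP; exists (\matrix_(t, j) c t j); apply/row_matrixP => t.
  rewrite row_mul row1 -cP; congr (_ *m _).
  by apply/rowP => j; rewrite !mxE.
by apply: etrans (eqP fullB); apply: esym; apply/eqP.
Qed.

Lemma sum_face_monomials D N : matroid D -> (0 < N)%N ->
  \sum_(f : {ffun 'I_n -> 'I_N} | supp (monomial_of f) \in D) 'X^(mdeg (monomial_of f))
  = \sum_(F in D) \prod_(i in F) \sum_(j < N | (0 < j)%N) ('X^j : {poly int}).
Proof.
case: N => // N mD _.
rewrite (partition_big (fun f => supp (monomial_of f)) (mem D)) //=.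
apply: eq_bigr => F FD; rewrite [RHS]big_mkcond /=.
(* A monomial has support [F] when its exponents are positive on [F] and zero elsewhere, a separate
   condition for each variable. *)
rewrite (eq_bigr (fun i => \sum_(j < N.+1 | ((0 < j)%N == (i \in F))) ('X^j : {poly int}))).
  rewrite bigA_distr_big_dep; apply: eq_big => [f|f _].
    apply/andP/familyP => [[_ /eqP <-] i|fF]; first by rewrite unfold_in /= inE mnmE.
    suff -> : supp (monomial_of f) = F by rewrite FD eqxx.
    by apply/setP=> i; have := fF i; rewrite unfold_in /= inE mnmE => /eqP.
  by rewrite mdegE -prodrXr; apply: eq_bigr => i _; rewrite mnmE.
move=> i _; case: (i \in F); first by apply: eq_bigl => j; rewrite eqb_id.
rewrite (big_pred1 ord0) => [|j] /=; first by rewrite expr0.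
by rewrite eqbF_neg -eqn0Ngt.
Qed.

Lemma hilbert_numerator D N : matroid D -> (0 < N)%N ->
  agree_below N
    ((1 - 'X) ^+ n * \sum_(f : {ffun 'I_n -> 'I_N} | supp (monomial_of f) \in D)
                        'X^(mdeg (monomial_of f)))
    (numerator D setT (fun=> 1%N)).
Proof.
move=> mD N0; rewrite sum_face_monomials // mulr_sumr.
(* On [F] the factor 1 - t turns the truncated t + ... + t^(N-1) into t - t^N, which agrees with t
   below N. *)
have -> : \sum_(F in D) (1 - 'X) ^+ n * \prod_(i in F) \sum_(j < N | (0 < j)%N) 'X^j
  = \sum_(F in D) (\prod_(i in F) ('X - 'X^N)) * \prod_(i in setT :\: F) (1 - 'X^1)
      :> {poly int}.
  apply: eq_bigr => F _; rewrite !prodr_const setTD -{1}[n]card_ord -(cardsC F).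
  rewrite exprD mulrAC -exprMn; congr (_ ^+ _ * _).
  have := geomE N; rewrite /geom; case: N N0 => // N _.
  rewrite (bigD1 ord0) //= expr0 mulrDr mulr1 => /(canRL (addKr _)) EN.
  rewrite (eq_bigl (fun j => j != ord0)) => [|j]; last by rewrite lt0n.
  by rewrite EN opprB addrA subrK.
apply: agree_below_sum => F; apply: agree_belowM => //.
apply: agree_below_prod => _ i ltiN.
by rewrite coefB !coefXn (ltn_eqF ltiN) subr0 ?coefX.
Qed.

Lemma h_vector_numerator D h : matroid D -> is_h_vector k D h ->
  (1 - 'X) ^+ (n - complex_rank D) * Poly h = numerator D setT (fun=> 1%N).
Proof.
move=> mD [_ [H [HP hE]]]; apply/polyP => N.
(* The coefficient of index [N] only sees monomials of degree at most [N], so exponents below [N.+1]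
   suffice. *)
pose P : {poly int} := \sum_(f : {ffun 'I_n -> 'I_N.+1} | supp (monomial_of f) \in D)
                        'X^(mdeg (monomial_of f)).
have PH i : (i < N.+1)%N -> P`_i = (H i)%:Z.
  move=> ltiN; rewrite (quotient_dim_card mD.1 ltiN (HP i)) coef_sum.
  rewrite -sum1_card -natz natr_sum big_mkcond [RHS]big_mkcond; apply: eq_bigr => f _.
  by rewrite inE coefXn [i == _]eq_sym; case: (_ \in D); case: eqP.
have hP : agree_below N.+1 (Poly h) ((1 - 'X) ^+ complex_rank D * P).
  move=> i ltiN; rewrite coef_Poly -hE coefM; apply: eq_bigr => -[j /= ltj] _.
  by rewrite PH //; lia.
have rk_n : (complex_rank D <= n)%N.
  by apply/bigmax_leqP => F _; rewrite -[n in (_ <= n)%N]card_ord max_card.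
have split_exp : (1 - 'X : {poly int}) ^+ n
    = (1 - 'X) ^+ (n - complex_rank D) * (1 - 'X) ^+ complex_rank D.
  by rewrite -exprD subnK.
rewrite -(hilbert_numerator mD (ltn0Sn N)) // split_exp -mulrA.
exact: (agree_belowM _ hP).
Qed.

Definition h_polynomial D : {poly int} :=
  \sum_(F in D) 'X^#|F| * (1 - 'X) ^+ (complex_rank D - #|F|).

Lemma numerator_h_polynomial D E : (forall F, F \in D -> F \subset E) ->
  numerator D E (fun=> 1%N) = (1 - 'X) ^+ (#|E| - complex_rank D) * h_polynomial D.
Proof.
move=> DE; rewrite mulr_sumr; apply: eq_bigr => F FD.
rewrite !prodr_const expr1 mulrCA -exprD cardsD (setIidPr (DE F FD)).
have rkE : (complex_rank D <= #|E|)%N by apply/bigmax_leqP => G /DE/subset_leq_card.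
have rkF := leq_rank FD.
by rewrite (_ : _ - #|F| = #|E| - complex_rank D + (complex_rank D - #|F|))%N //; lia.
Qed.

Lemma coef_exp_1subX d i : (d <= i)%N ->
  ((1 - 'X : {poly int}) ^+ d)`_i = if i == d then (-1) ^+ d else 0.
Proof.
elim: d i => [|d IHd] i ledi; first by rewrite expr0 coef1; case: eqP.
case: i ledi => // i ledi; rewrite exprS mulrBl mul1r coefB coefXM.
rewrite IHd; last exact: ltnW.
rewrite IHd // (gtn_eqF ledi) eqSS /=.
by case: eqP => _; rewrite ?subr0 // sub0r exprS mulN1r.
Qed.

(** Each summand has degree equal to the rank, with leading coefficient the sign of its face in
    [tau D]. *)
Lemma coef_h_polynomial D i : (complex_rank D <= i)%N ->
  (h_polynomial D)`_i = if i == complex_rank D then tau D else 0.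
Proof.
move=> ler; rewrite coef_sum; have [ir|ir] := eqVneq i (complex_rank D).
  rewrite ir; apply: eq_bigr => F FD; rewrite coefXnM ltnNge leq_rank //=.
  by rewrite coef_exp_1subX // eqxx.
rewrite big1 // => F /leq_rank leF; rewrite coefXnM; case: ifP => // _.
rewrite coef_exp_1subX ?leq_sub2r // ifF //; apply/eqP => e; case/eqP: ir.
by lia.
Qed.

Lemma last_h_polynomial D h : last 0 h != 0 -> Poly h = h_polynomial D ->
  tau D != 0 -> last 0 h = tau D.
Proof.
move=> h_last hD tau_neq0.
have h_rk i : (complex_rank D <= i)%N -> h`_i = if i == complex_rank D then tau D else 0.
  by move=> /coef_h_polynomial; rewrite -hD coef_Poly.
have size_h : size h = (complex_rank D).+1.
  apply/eqP; rewrite eqn_leq ltnNge; apply/andP; split; last first.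
    by apply: contraNN tau_neq0 => /(nth_default 0); rewrite h_rk // eqxx => ->.
  rewrite leqNgt; apply: contraNN h_last => lt_h.
  by rewrite -nth_last h_rk ?ifF //; lia.
by rewrite -nth_last size_h h_rk // eqxx.
Qed.

End HilbertFunction.

(** * Graded free resolutions *)

(** Chain maps and homotopies are infinite families whose next member is only known to exist; [P] is
    the invariant that allows the next step, [Q] the relation between neighbours. *)
Lemma dependent_choice (T : nat -> Type) (P : forall i, T i -> Prop)
    (Q : forall i, T i -> T i.+1 -> Prop) (x0 : T 0%N) : P 0%N x0 ->
  (forall i x, P i x -> exists y, Q i x y /\ P i.+1 y) ->
  exists f : forall i, T i, f 0%N = x0 /\ forall i, P i (f i) /\ Q i (f i) (f i.+1).
Proof.
move=> P0 step.
have next i (x : {x | P i x}) : {y : {y | P i.+1 y} | Q i (sval x) (sval y)}.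
  apply: constructive_indefinite_description; case: x => x Px.
  by have [y [Qy Py]] := step i x Px; exists (exist _ y Py).
pose f := fix f i : {x | P i x} :=
  if i is j.+1 then sval (next j (f j)) else exist _ x0 P0.
exists (fun i => sval (f i)); split=> // i; split; first exact: svalP.
exact: svalP (next i (f i)).
Qed.

Section Resolutions.
Variables (k : fieldType) (n : nat).
Local Notation S := {mpoly k[n]}.
Implicit Types (I J L : S -> Prop) (p q : S).

Definition is_ideal I :=
  [/\ I 0, forall p q, I p -> I q -> I (p + q) & forall p q, I q -> I (p * q)].

Lemma idealN I p : is_ideal I -> I p -> I (- p).
Proof. by case=> _ _ IM Ip; rewrite -mulN1r; apply: IM. Qed.

Lemma idealB I p q : is_ideal I -> I p -> I q -> I (p - q).
Proof. by move=> iI Ip Iq; case: (iI) => _ ID _; apply: ID => //; apply: idealN. Qed.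

Lemma ideal_mulmx I m1 m2 m3 (A : 'M[S]_(m1, m2)) (B : 'M[S]_(m2, m3)) :
  is_ideal I -> (forall r c, I (B r c)) -> forall r c, I ((A *m B) r c).
Proof.
move=> [I0 ID IM] IB r c; rewrite mxE.
by elim/big_rec: _ => // j p _ Ip; apply: ID => //; apply: IM.
Qed.

(* The component of degree a - b of p, which is 0 if a < b. *)
Definition component (a b : nat) p : S :=
  \sum_(m <- msupp p | (mdeg m + b == a)%N) p@_m *: 'X_[m].

Lemma mcoeff_component (a b : nat) p m :
  (component a b p)@_m = if (mdeg m + b == a)%N then p@_m else 0.
Proof.
rewrite raddf_sum /= big_mkcond /=.
have [mp|mp] := boolP (m \in msupp p); last first.
  rewrite (memN_msupp_eq0 mp) if_same big_seq big1 // => u up; case: ifP => // _.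
  rewrite mcoeffZ mcoeffX; case: eqP => [um|]; last by rewrite mulr0.
  by rewrite um (negPf mp) in up.
rewrite (bigD1_seq m) ?msupp_uniq //= big1 ?addr0 => [|u um].
  by case: ifP => // _; rewrite mcoeffZ mcoeffX eqxx mulr1.
by case: ifP => // _; rewrite mcoeffZ mcoeffX (negPf um) mulr0.
Qed.

Lemma componentD (a b : nat) p q : component a b (p + q) = component a b p + component a b q.
Proof.
by apply/mpolyP => m; rewrite mcoeffD !mcoeff_component; case: ifP; rewrite ?mcoeffD ?addr0.
Qed.

Lemma component_sum (a b : nat) (T : Type) (r : seq T) (P : pred T) (f : T -> S) :
  component a b (\sum_(i <- r | P i) f i) = \sum_(i <- r | P i) component a b (f i).
Proof.
apply: (big_morph (component a b) (componentD a b)).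
by apply/mpolyP => m; rewrite mcoeff_component mcoeff0 if_same.
Qed.

Lemma componentZX (a b : nat) (z : k) m :
  component a b (z *: 'X_[m]) = if (mdeg m + b == a)%N then z *: 'X_[m] else 0.
Proof.
apply/mpolyP => u; rewrite mcoeff_component mcoeffZ mcoeffX.
case: (eqVneq m u) => [->|mu]; case: ifP => _; try (case: ifP => _);
  by rewrite ?mcoeff0 ?mcoeffZ ?mcoeffX ?eqxx ?(negPf mu) ?mulr0.
Qed.

Lemma component_id (a b : nat) p : (forall m, m \in msupp p -> (mdeg m + b = a)%N) ->
  component a b p = p.
Proof.
move=> hp; apply/mpolyP => m; rewrite mcoeff_component; case: ifP => // /eqP ma.
by apply/esym/memN_msupp_eq0/negP => /hp.
Qed.

Lemma component_mul (a b c : nat) p q : (forall m, m \in msupp q -> (mdeg m + c = b)%N) ->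
  component a c (p * q) = component a b p * q.
Proof.
move=> hq; rewrite [p]mpolyE {1}[q]mpolyE !component_sum mulr_suml component_sum mulr_suml.
apply: eq_bigr => u _; rewrite mulr_sumr component_sum [in RHS](mpolyE q) mulr_sumr.
rewrite !big_seq; apply: eq_bigr => v vq.
rewrite -scalerAr -scalerAl -mpolyXD scalerA !componentZX mdegD -addnA hq //.
case: ifP => _; last by rewrite mul0r.
by rewrite -scalerAr -scalerAl -mpolyXD scalerA.
Qed.

Definition homogeneous_mx m1 m2 (s : 'rV[nat]_m1) (t : 'rV[nat]_m2)
    (A : 'M[S]_(m1, m2)) : Prop :=
  forall r c u, u \in msupp (A r c) -> (mdeg u + t 0%R c)%N = s 0 r.

Lemma homogeneous_mx0 m1 m2 (s : 'rV[nat]_m1) (t : 'rV[nat]_m2) :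
  homogeneous_mx s t 0.
Proof. by move=> r c u; rewrite mxE msupp0. Qed.

Lemma homogeneous_mxN m1 m2 (s : 'rV[nat]_m1) (t : 'rV[nat]_m2) A :
  homogeneous_mx s t A -> homogeneous_mx s t (- A).
Proof. by move=> hA r c u; rewrite mxE (perm_mem (msuppN _)); apply: hA. Qed.

Lemma homogeneous_mxM m1 m2 m3 (s : 'rV[nat]_m1) (t : 'rV[nat]_m2) (v : 'rV[nat]_m3)
    A B : homogeneous_mx s t A -> homogeneous_mx t v B -> homogeneous_mx s v (A *m B).
Proof.
move=> hA hB r c u; rewrite mxE => /msupp_sum_le/flattenP[l /mapP[j _ ->]].
move=> /msuppM_le/allpairsP[[u1 u2] /= [/hA <- /hB <- ->]].
by rewrite mdegD addnA.
Qed.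

Lemma homogeneous_row_mx m1 m2 m3 (s : 'rV[nat]_m1) (t : 'rV[nat]_m2) (v : 'rV[nat]_m3)
    A B : homogeneous_mx s t A -> homogeneous_mx s v B ->
  homogeneous_mx s (row_mx t v) (row_mx A B).
Proof.
move=> hA hB r c u; case: (split_ordP c) => j ->; rewrite ?row_mxEl ?row_mxEr.
  exact: hA.
exact: hB.
Qed.

Lemma homogeneous_col_mx m1 m2 m3 (s : 'rV[nat]_m1) (t : 'rV[nat]_m2) (v : 'rV[nat]_m3)
    A B : homogeneous_mx s v A -> homogeneous_mx t v B ->
  homogeneous_mx (row_mx s t) v (col_mx A B).
Proof.
move=> hA hB r c u; case: (split_ordP r) => j ->.
  by rewrite row_mxEl col_mxEu; apply: hA.
by rewrite row_mxEr col_mxEd; apply: hB.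
Qed.

Lemma matrix_lift m1 m2 m3 (W : 'M[S]_(m1, m3)) (D : 'M[S]_(m2, m3)) :
  (forall r, exists v, row r W = v *m D) -> exists V, W = V *m D.
Proof.
move=> /fin_all_exists[v vP]; exists (\matrix_r v r).
by apply/row_matrixP => r; rewrite row_mul rowK vP.
Qed.

(** Take any lift and keep in each entry only the component of the prescribed degree; as [W] and [D]
    are homogeneous, the discarded parts contribute nothing. *)
Lemma homogeneous_lift m1 m2 m3 (s : 'rV[nat]_m1) (t : 'rV[nat]_m2) (v : 'rV[nat]_m3)
    (W : 'M[S]_(m1, m3)) (D : 'M[S]_(m2, m3)) :
  homogeneous_mx s v W -> homogeneous_mx t v D ->
  (forall r, exists u, row r W = u *m D) ->
  exists V, W = V *m D /\ homogeneous_mx s t V.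
Proof.
move=> hW hD /matrix_lift[V WE].
exists (\matrix_(r, j) component (s 0 r) (t 0 j) (V r j)); split.
  apply/matrixP => r c; rewrite -[LHS](component_id (hW r c)) WE !mxE component_sum.
  by apply: eq_bigr => j _; rewrite mxE; apply: component_mul; apply: hD.
move=> r j u; rewrite mxE mcoeff_msupp mcoeff_component.
by case: ifP => [/eqP //|]; rewrite eqxx.
Qed.

Record free_complex := FreeComplex {
  fc_rank : nat -> nat;
  fc_shift : forall i, 'rV[nat]_(fc_rank i);
  fc_diff : forall i, 'M[S]_(fc_rank i.+1, fc_rank i);
  fc_aug : 'cV[S]_(fc_rank 0)
}.

(* F resolves S/I, the augmentation sending the generator c of F_0 to the class
   of fc_aug c. Unlike in a minimal resolution F_0 may have rank > 1. *)
Record graded_resolution I (F : free_complex) : Prop := GradedResolution {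
  gr_homog : forall i, homogeneous_mx (fc_shift F i.+1) (fc_shift F i) (fc_diff F i);
  gr_homog_aug : homogeneous_mx (fc_shift F 0) (const_mx 0%N) (fc_aug F);
  gr_aug : forall w : 'rV_(fc_rank F 0),
    I ((w *m fc_aug F) 0 0) <-> exists v, w = v *m fc_diff F 0;
  gr_exact : forall i (w : 'rV_(fc_rank F i.+1)),
    w *m fc_diff F i = 0 <-> exists v, w = v *m fc_diff F i.+1;
  gr_surj : exists2 v : 'rV_(fc_rank F 0), homogeneous_mx (const_mx 0%N) (fc_shift F 0) v
    & I ((v *m fc_aug F) 0 0 - 1)
}.

Section Exactness.
Variables (I : S -> Prop) (F : free_complex).
Hypothesis resF : graded_resolution I F.

Lemma gr_diff_diff i : fc_diff F i.+1 *m fc_diff F i = 0.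
Proof.
apply/row_matrixP => r; rewrite row_mul row0; apply/(gr_exact resF).
by exists (delta_mx 0 r); rewrite rowE.
Qed.

Lemma gr_diff_aug r c : I ((fc_diff F 0 *m fc_aug F) r c).
Proof.
have /(gr_aug resF) : exists v, row r (fc_diff F 0) = v *m fc_diff F 0.
  by exists (delta_mx 0 r); rewrite rowE.
by rewrite -row_mul mxE (ord1 c).
Qed.

Lemma gr_aug_row m (W : 'M_(m, _)) : (forall r, I ((W *m fc_aug F) r 0)) ->
  forall r, exists v, row r W = v *m fc_diff F 0.
Proof. by move=> IW r; apply/(gr_aug resF); rewrite -row_mul mxE. Qed.

Lemma gr_exact_row i m (W : 'M_(m, _)) : W *m fc_diff F i = 0 ->
  forall r, exists v, row r W = v *m fc_diff F i.+1.
Proof. by move=> W0 r; apply/(gr_exact resF); rewrite -row_mul W0 row0. Qed.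

End Exactness.

Lemma eq_graded_resolution I J F : (forall p, I p <-> J p) ->
  graded_resolution I F -> graded_resolution J F.
Proof.
move=> IJ [homF haF augF exF [v hv Iv]]; split=> // [w|]; first by rewrite -IJ.
by exists v => //; apply/IJ.
Qed.

Lemma comparison I J F G : is_ideal J -> (forall p, I p -> J p) ->
  graded_resolution I F -> graded_resolution J G ->
  exists f : forall i, 'M[S]_(fc_rank F i, fc_rank G i),
    [/\ forall c, J ((fc_aug F - f 0%N *m fc_aug G) c 0),
        forall i, f i.+1 *m fc_diff G i = fc_diff F i *m f i
      & forall i, homogeneous_mx (fc_shift F i) (fc_shift G i) (f i)].
Proof.
move=> iJ IJ resF resG; have [v hv Jv] := gr_surj resG.
(* [v] represents 1 modulo [J], so multiples of [v] lift the augmentations of the generators of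
   [F]. *)
pose f0 := fc_aug F *m v.
have Jf0 c : J ((fc_aug F - f0 *m fc_aug G) c 0).
  rewrite -mulmxA mxE [X in _ + X]mxE [X in _ - X]mxE big_ord1 -[X in X - _]mulr1 -mulrBr.
  by case: (iJ) => _ _; apply; rewrite -opprB; apply: idealN.
pose P i (f : 'M_(fc_rank F i, fc_rank G i)) :=
  homogeneous_mx (fc_shift F i) (fc_shift G i) f /\
  forall r, exists u, row r (fc_diff F i *m f) = u *m fc_diff G i.
pose Q i (f : 'M_(fc_rank F i, fc_rank G i)) (g : 'M_(fc_rank F i.+1, fc_rank G i.+1)) :=
  g *m fc_diff G i = fc_diff F i *m f.
have [||f [f0E fP]] := @dependent_choice _ P Q f0.
- split; first exact: homogeneous_mxM (gr_homog_aug resF) hv.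
  apply: (gr_aug_row resG) => r; rewrite -mulmxA.
  have -> : f0 *m fc_aug G = fc_aug F - (fc_aug F - f0 *m fc_aug G).
    by rewrite opprB addrC subrK.
  rewrite mulmxBr mxE [X in _ + X]mxE; apply: idealB => //.
    exact/IJ/(gr_diff_aug resF).
  by apply: ideal_mulmx => // r' c'; rewrite (ord1 c').
- move=> i f [hf fim].
  have hdf := homogeneous_mxM (@gr_homog _ _ resF i) hf.
  have [g [gE hg]] := homogeneous_lift hdf (@gr_homog _ _ resG i) fim.
  exists g; split; first by rewrite /Q -gE.
  split=> //; apply: (gr_exact_row resG).
  by rewrite -mulmxA -gE mulmxA (gr_diff_diff resF) mul0mx.
exists f; split=> [c|i|i]; last by have [[]] := fP i.
  by rewrite f0E.
by have [] := fP i.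
Qed.

Lemma null_homotopy I F (f : forall i, 'M[S]_(fc_rank F i)) :
  graded_resolution I F -> (forall c, I ((f 0%N *m fc_aug F) c 0)) ->
  (forall i, f i.+1 *m fc_diff F i = fc_diff F i *m f i) ->
  exists h : forall i, 'M[S]_(fc_rank F i, fc_rank F i.+1),
    f 0%N = h 0%N *m fc_diff F 0 /\
    forall i, f i.+1 = fc_diff F i *m h i + h i.+1 *m fc_diff F i.+1.
Proof.
move=> resF If fd; have [h0 f0E] := matrix_lift (gr_aug_row resF If).
(* This says that [f i.+1] minus [fc_diff F i *m h] is killed by the differential, hence lifts to
   the next homotopy. *)
pose P i (h : 'M[S]_(fc_rank F i, fc_rank F i.+1)) :=
  fc_diff F i *m h *m fc_diff F i = fc_diff F i *m f i.
pose Q i (h : 'M[S]_(fc_rank F i, fc_rank F i.+1))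
         (h' : 'M[S]_(fc_rank F i.+1, fc_rank F i.+2)) :=
  f i.+1 = fc_diff F i *m h + h' *m fc_diff F i.+1.
have [||h [h0E hP]] := @dependent_choice _ P Q h0.
- by rewrite /P f0E mulmxA.
- move=> i h hi; have : (f i.+1 - fc_diff F i *m h) *m fc_diff F i = 0.
    by rewrite mulmxBl fd hi subrr.
  move/(gr_exact_row resF)/matrix_lift => [h' h'E]; exists h'.
  have fE : f i.+1 = fc_diff F i *m h + h' *m fc_diff F i.+1 by rewrite -h'E addrC subrK.
  by split=> //; rewrite /P fE mulmxDr !mulmxA (gr_diff_diff resF) mul0mx add0r.
by exists h; split=> [|i]; rewrite ?h0E //; have [] := hP i.
Qed.

End Resolutions.

(** * Mapping cones of graded resolutions *)

Section Cone.
Variables (k : fieldType) (n : nat).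
Local Notation S := {mpoly k[n]}.
Implicit Types (I J L : S -> Prop) (p q : S).

Lemma homogeneous_mx_succ m1 m2 (s : 'rV[nat]_m1) (t : 'rV[nat]_m2) (A : 'M[S]_(m1, m2)) :
  homogeneous_mx s t A -> homogeneous_mx (map_mx succn s) (map_mx succn t) A.
Proof. by move=> hA r c u /hA uA; rewrite !mxE addnS uA. Qed.

Lemma homogeneous_scale_var e m1 m2 (s : 'rV[nat]_m1) (t : 'rV[nat]_m2) (A : 'M[S]_(m1, m2)) :
  homogeneous_mx s t A -> homogeneous_mx (map_mx succn s) t ('X_e *: A).
Proof.
move=> hA r c u; rewrite !mxE mulrC (perm_mem (msuppMX _ _)) => /mapP[v /hA <- ->].
by rewrite mdegD mdeg1.
Qed.

Lemma homogeneous_scalar_var e m (s : 'rV[nat]_m) :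
  homogeneous_mx (map_mx succn s) s (('X_e)%:M : 'M[S]_m).
Proof.
rewrite -scalemx1; apply: homogeneous_scale_var => r c u; rewrite mxE.
by case: eqP => [->|_]; rewrite ?msupp0 // msupp1 inE => /eqP->; rewrite mdeg0.
Qed.

Section Construction.
Variables (e : 'I_n) (A B : free_complex k n).
Variable phi : forall i, 'M[S]_(fc_rank A i, fc_rank B i).

(** The summand A(-1) enters the cone one homological degree higher; in degree 0 it is absent. *)
Definition prev_rank i := if i is j.+1 then fc_rank A j else 0%N.

Definition prev_shift i : 'rV[nat]_(prev_rank i) :=
  if i is j.+1 return 'rV_(prev_rank i) then map_mx succn (fc_shift A j) else 0.

Definition prev_diff i : 'M[S]_(fc_rank A i, prev_rank i) :=
  if i is j.+1 return 'M_(fc_rank A i, prev_rank i) then - fc_diff A j else 0.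

(* The mapping cone of (x_e, - phi) : A(-1) -> A + B(-1). *)
Definition cone := FreeComplex
  (fun i => row_mx (row_mx (fc_shift A i) (map_mx succn (fc_shift B i))) (prev_shift i))
  (fun i => block_mx (block_mx (fc_diff A i) 0 0 (fc_diff B i)) 0
     (row_mx ('X_e)%:M (- phi i)) (prev_diff i))
  (col_mx (col_mx (fc_aug A) ('X_e *: fc_aug B)) (0 : 'cV_(prev_rank 0))).

Lemma cone_mul_diff i m (a : 'M_(m, fc_rank A i.+1)) (b : 'M_(m, fc_rank B i.+1))
    (c : 'M_(m, fc_rank A i)) :
  row_mx (row_mx a b) c *m fc_diff cone i =
  row_mx (row_mx (a *m fc_diff A i + 'X_e *: c) (b *m fc_diff B i - c *m phi i))
    (c *m prev_diff i).
Proof.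
rewrite /= mul_row_block mul_row_block mul_mx_row !mulmx0 !addr0 !add0r add_row_mx.
by rewrite mulmxN mul_mx_scalar.
Qed.

Lemma cone_mul_aug m (a : 'M_(m, fc_rank A 0)) (b : 'M_(m, fc_rank B 0)) (c : 'M_(m, 0)) :
  row_mx (row_mx a b) c *m fc_aug cone = a *m fc_aug A + 'X_e *: (b *m fc_aug B).
Proof. by rewrite /= !mul_row_col mulmx0 addr0 scalemxAr. Qed.

End Construction.

(* The hypotheses say that 0 -> S/J(-1) -> S/J + S/L(-1) -> S/I -> 0 is exact, with
   maps (x_e, -1) and (1, x_e). *)
Lemma cone_resolution e I J L A B : is_ideal J -> is_ideal L ->
  (forall p, J p -> L p) -> (forall p, J ('X_e * p) -> J p) ->
  (forall p q, I (p + 'X_e * q) <-> exists s, J (p + 'X_e * s) /\ L (q - s)) ->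
  graded_resolution J A -> graded_resolution L B ->
  exists phi : forall i, 'M[S]_(fc_rank A i, fc_rank B i), graded_resolution I (cone e phi).
Proof.
move=> iJ iL JL Jx IE resA resB.
have [phi [phi0 phid hphi]] := comparison iL JL resA resB.
exists phi.
have split_row i (w : 'rV[S]_(fc_rank (cone e phi) i)) :
    exists a b c, w = row_mx (row_mx a b) c.
  by exists (lsubmx (lsubmx w)), (rsubmx (lsubmx w)), (rsubmx w); rewrite !hsubmxK.
have prev_diff_diff i : prev_diff A i.+1 *m prev_diff A i = 0.
  case: i => [|i] /=; first by rewrite mulmx0.
  by rewrite mulNmx mulmxN opprK (gr_diff_diff resA).
have cone_diff_diff i : fc_diff (cone e phi) i.+1 *m fc_diff (cone e phi) i = 0.
  apply/row_matrixP => r; rewrite row_mul row0 rowE.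
  have [a [b [c ->]]] := split_row _ (delta_mx 0 r).
  rewrite !cone_mul_diff.
  have -> : (a *m fc_diff A i.+1 + 'X_e *: c) *m fc_diff A i
              + 'X_e *: (c *m prev_diff A i.+1) = 0.
    rewrite mulmxDl -mulmxA (gr_diff_diff resA) mulmx0 add0r -scalemxAl /=.
    by rewrite mulmxN scalerN subrr.
  have -> : (b *m fc_diff B i.+1 - c *m phi i.+1) *m fc_diff B i
              - c *m prev_diff A i.+1 *m phi i = 0.
    rewrite mulmxBl -(mulmxA b) (gr_diff_diff resB) mulmx0 sub0r -!(mulmxA c) phid /=.
    by rewrite mulNmx mulmxN opprK addNr.
  have -> : c *m prev_diff A i.+1 *m prev_diff A i = 0.
    by rewrite -mulmxA prev_diff_diff mulmx0.
  by rewrite !row_mx0.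
split.
- move=> i; apply: homogeneous_col_mx.
    apply: homogeneous_row_mx; last exact: homogeneous_mx0.
    apply: homogeneous_col_mx; apply: homogeneous_row_mx; try exact: homogeneous_mx0.
      exact: (@gr_homog _ _ _ _ resA i).
    exact/homogeneous_mx_succ/(@gr_homog _ _ _ _ resB i).
  apply: homogeneous_row_mx; last first.
    case: i => [|i] /=; first exact: homogeneous_mx0.
    exact/homogeneous_mxN/homogeneous_mx_succ/(@gr_homog _ _ _ _ resA i).
  apply: homogeneous_row_mx; first exact: homogeneous_scalar_var.
  exact/homogeneous_mxN/homogeneous_mx_succ/hphi.
- apply: homogeneous_col_mx; last exact: homogeneous_mx0.
  apply: homogeneous_col_mx; first exact: gr_homog_aug resA.
  exact/homogeneous_scale_var/(gr_homog_aug resB).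
- move=> w; have [a [b [c ->]]] := split_row _ w.
  rewrite cone_mul_aug mxE [X in _ + X]mxE IE; split.
    (* [s *: v] lifts the class of [s] to the module A_0. Its negative is the A(-1) coordinate of
       the preimage; the other two coordinates correct the remaining errors in [A] and [B]. *)
    move=> [s [Js Ls]]; have [v _ Jv] := gr_surj resA.
    have Jsv : J (s * ((v *m fc_aug A) 0 0) - s).
      by rewrite -[X in _ - X]mulr1 -mulrBr; case: (iJ) => _ _; apply.
    have /(gr_aug resA)[al alE] : J (((a + 'X_e *: (s *: v)) *m fc_aug A) 0 0).
      rewrite mulmxDl -!scalemxAl mxE [X in _ + X]mxE [X in _ * X]mxE.
      move: Js Jsv; set pa := (a *m _) 0 0; set pv := (v *m _) 0 0 => Js Jsv.
      have -> : pa + 'X_e * (s * pv) = (pa + 'X_e * s) + 'X_e * (s * pv - s) by ring.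
      by case: (iJ) => _ JD JM; apply: JD => //; apply: JM.
    have /(gr_aug resB)[be beE] : L (((b - s *: (v *m phi 0%N)) *m fc_aug B) 0 0).
      have : L ((v *m (fc_aug A - phi 0%N *m fc_aug B)) 0 0).
        by apply: ideal_mulmx => // r c'; rewrite (ord1 c').
      rewrite mulmxBr mxE [X in _ + X]mxE => Lv.
      rewrite mulmxBl -scalemxAl mxE [X in _ + X]mxE [X in _ - X]mxE -mulmxA.
      move: Ls (JL _ Jsv) Lv; set qb := (b *m _) 0 0; set pv := (v *m _) 0 0.
      set qv := (v *m (_ *m _)) 0 0 => Ls Lsv Lv.
      have -> : qb - s * qv = (qb - s) - (s * pv - s) + s * (pv - qv) by ring.
      case: (iL) => _ LD LM; apply: LD; last exact: LM.
      exact: idealB.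
    exists (row_mx (row_mx al be) (- (s *: v))); rewrite cone_mul_diff.
    rewrite -alE -beE scalerN addrK mulNmx opprK -scalemxAl subrK.
    by congr row_mx; apply/rowP; case.
  move=> [w' wE]; have [al [be [c' w'E]]] := split_row _ w'.
  move: wE; rewrite w'E cone_mul_diff => /eq_row_mx[/eq_row_mx[-> ->] _].
  (* Conversely, [s] is read off from the A(-1) coordinate of the given preimage. *)
  exists (- (c' *m fc_aug A) 0 0).
  rewrite mulmxDl -scalemxAl mxE [X in _ + X + _]mxE mulrN addrK mulmxBl.
  rewrite -!mulmxA opprK; split.
    by apply: ideal_mulmx => // r c0; apply: (gr_diff_aug resA).
  rewrite mxE [X in _ + X + _]mxE -addrA [- _ + _]addrC.
  have -> : (c' *m fc_aug A) 0 0 - (c' *m (phi 0%N *m fc_aug B)) 0 0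
      = (c' *m (fc_aug A - phi 0%N *m fc_aug B)) 0 0.
    by rewrite mulmxBr [RHS]mxE [X in _ = _ + X]mxE.
  case: (iL) => _ LD _; apply: LD.
    by apply: ideal_mulmx => // r c0; apply: (gr_diff_aug resB).
  by apply: ideal_mulmx => // r c0; rewrite (ord1 c0).
- move=> i w; split; last first.
    by move=> [v ->]; rewrite -mulmxA cone_diff_diff mulmx0.
  have [a [b [c ->]]] := split_row _ w; rewrite cone_mul_diff.
  rewrite -[0 in RHS](row_mx0 _ _ _ _) => /eq_row_mx[+ Rc].
  rewrite -[0 in RHS](row_mx0 _ _ _ _) => /eq_row_mx[Pa Qb].
  (* In positive degrees this is exactness of [A]. At the bottom only x_e times the class of [c] is
     known to vanish, and [Jx] cancels x_e. *)
  have [u cE] : exists u, c = u *m fc_diff A i.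
    case: i {w} a b c Pa Qb Rc => [|i] a b c Pa Qb /= Rc.
      apply/(gr_aug resA)/Jx.
      have := congr1 (fun M => (M *m fc_aug A) 0 0) Pa.
      rewrite mul0mx mulmxDl -scalemxAl mxE [X in _ + X]mxE [RHS]mxE.
      move/(canRL (addKr _)) => ->; rewrite addr0 -mulmxA; apply: idealN => //.
      by apply: ideal_mulmx => // r c0; apply: (gr_diff_aug resA).
    by apply/(gr_exact resA)/eqP; rewrite -oppr_eq0 -mulmxN Rc.
  have /(gr_exact resA)[al alE] : (a + 'X_e *: u) *m fc_diff A i = 0.
    by rewrite mulmxDl -scalemxAl -cE.
  have /(gr_exact resB)[be beE] : (b - u *m phi i.+1) *m fc_diff B i = 0.
    by rewrite mulmxBl -mulmxA phid mulmxA -cE.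
  exists (row_mx (row_mx al be) (- u)); rewrite cone_mul_diff.
  by rewrite -alE -beE scalerN addrK mulNmx opprK subrK /= mulNmx mulmxN opprK -cE.
have [v hv Jv] := gr_surj resA.
exists (row_mx (row_mx v 0) 0).
  by apply: homogeneous_row_mx; [apply: homogeneous_row_mx => //|]; apply: homogeneous_mx0.
rewrite cone_mul_aug mul0mx scaler0 addr0.
have := IE ((v *m fc_aug A) 0 0 - 1) 0; rewrite mulr0 addr0 => ->.
by exists 0; rewrite mulr0 addr0 subrr; split=> //; case: iL.
Qed.
End Cone.

(** * The type of a matroid *)

Section MinimalResolution.
Variables (k : fieldType) (n : nat).
Local Notation S := {mpoly k[n]}.
Implicit Types (I : S -> Prop) (F G : free_complex k n).

Definition complex_of_resolution I (R : min_graded_free_resolution I) : free_complex k n :=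
  FreeComplex (fun i => \row_c @shift _ _ _ R i c) (@diff _ _ _ R) (const_mx 1).

(** [betti R 0] equals 1 only propositionally; an arbitrary index [c] avoids casts. *)
Lemma sum_ord1 (V : nmodType) m (g : 'I_m -> V) c : m = 1%N -> \sum_i g i = g c.
Proof. by move=> m1; subst m; rewrite big_ord1 (ord1 c). Qed.

Lemma complex_of_resolutionP I (R : min_graded_free_resolution I) :
  graded_resolution I (complex_of_resolution R).
Proof.
case: R => b s d b0 s0 hd axd exd mind; rewrite /complex_of_resolution /=.
split=> /=.
- by move=> i r c u; rewrite !mxE => /hd.
- move=> r c u; rewrite !mxE mcoeff_msupp mcoeff1.
  by case: (u =P 0%MM) => [-> _|_]; rewrite ?mdeg0 ?s0 ?eqxx.
- move=> w; rewrite -axd mxE.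
  have wE c : \sum_j w 0 j * (const_mx 1 : 'cV[S]_(b 0%N)) j 0 = w 0 c.
    by rewrite (sum_ord1 _ c b0) mxE mulr1.
  split=> [Iw c|Iw]; first by rewrite -(wE c).
  have c : 'I_(b 0%N) by rewrite b0; exact: ord0.
  by rewrite (wE c).
- exact: exd.
exists (const_mx 1) => [r c u|].
  rewrite !mxE mcoeff_msupp mcoeff1.
  by case: (u =P 0%MM) => [-> _|_]; rewrite ?mdeg0 ?s0 ?eqxx.
have c : 'I_(b 0%N) by rewrite b0; exact: ord0.
rewrite mxE (sum_ord1 _ c b0) !mxE mulr1 subrr.
have /axd/(_ c) : exists v, (0 : 'rV[S]_(b 0%N)) = v *m d 0%N.
  by exists 0; rewrite mul0mx.
by rewrite mxE.
Qed.

(** The composite minus the identity lifts the zero map of S/I, so it is null-homotopic. *)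
Lemma homotopy_identity I F G (f : forall i, 'M[S]_(fc_rank F i, fc_rank G i))
    (g : forall i, 'M[S]_(fc_rank G i, fc_rank F i)) :
  is_ideal I -> graded_resolution I F ->
  (forall c, I ((fc_aug F - f 0%N *m fc_aug G) c 0)) ->
  (forall c, I ((fc_aug G - g 0%N *m fc_aug F) c 0)) ->
  (forall i, f i.+1 *m fc_diff G i = fc_diff F i *m f i) ->
  (forall i, g i.+1 *m fc_diff F i = fc_diff G i *m g i) ->
  exists h : forall i, 'M[S]_(fc_rank F i, fc_rank F i.+1),
    f 0%N *m g 0%N = 1%:M + h 0%N *m fc_diff F 0 /\
    forall i, f i.+1 *m g i.+1
      = 1%:M + (fc_diff F i *m h i + h i.+1 *m fc_diff F i.+1).
Proof.
move=> iI resF If Ig fd gd.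
have [||h [h0 hS]] := null_homotopy (f := fun i => f i *m g i - 1%:M) resF.
- move=> c; rewrite mulmxBl mul1mx.
  have -> : f 0%N *m g 0%N *m fc_aug F - fc_aug F =
    - (fc_aug F - f 0%N *m fc_aug G) - f 0%N *m (fc_aug G - g 0%N *m fc_aug F).
    by rewrite mulmxBr !opprB mulmxA [RHS]addrC addrA subrK.
  rewrite mxE [X in X + _]mxE [X in _ + X]mxE; apply: idealB => //.
    exact: idealN.
  by apply: ideal_mulmx => // r c'; rewrite (ord1 c').
- move=> i; rewrite mulmxBl mulmxBr mul1mx mulmx1 -mulmxA gd !mulmxA.
  by rewrite -fd.
by exists h; split=> [|i]; rewrite -?hS -?h0 addrC subrK.
Qed.

(** Reduction modulo the variables; minimality says that it kills the differentials of [R]. *)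
Definition constant_mx m1 m2 (A : 'M[S]_(m1, m2)) : 'M[k]_(m1, m2) :=
  map_mx (mcoeff 0%MM) A.

(* Comparison with F minimal: F -> G -> F is the identity modulo the variables,
   and so is G -> F -> G on the generators of G_c of degree N, whose image under
   the differential has coefficients of positive degree. *)
Lemma minimal_resolution_bound I (R : min_graded_free_resolution I) G c N :
  is_ideal I -> graded_resolution I G ->
  (forall i, (c < i)%N -> fc_rank G i = 0%N) ->
  (forall i j, i.+1 = c -> (fc_shift G i 0%R j < N)%N) ->
  (forall i, (c < i)%N -> betti R i = 0%N) /\
  (\sum_(j < fc_rank G c) (fc_shift G c 0%R j == N) <= betti R c)%N.
Proof.
move=> iI resG rk0 shN; have resF := complex_of_resolutionP R.
set F := complex_of_resolution R in resF.
have minF i : constant_mx (fc_diff F i) = 0.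
  have diff0 (R' : min_graded_free_resolution I) : forall j r c', (diff R' j r c')@_0%MM = 0.
    by case: R'.
  by apply/matrixP => r c'; rewrite !mxE diff0.
have [f [If fd _]] := comparison iI (fun p => id) resF resG.
have [g [Ig gd _]] := comparison iI (fun p => id) resG resF.
have [h [h0 hS]] := homotopy_identity iI resF If Ig fd gd.
have [h' [h0' hS']] := homotopy_identity iI resG Ig If gd fd.
split=> [i lti|].
  (* Both homotopy terms vanish modulo the variables, so an identity of size [betti R i] factors
     through a space of dimension 0. *)
  have fg : constant_mx (f i) *m constant_mx (g i) = 1%:M.
    rewrite -map_mxM; case: (i) => [|j].
      by rewrite h0 map_mxD map_mx1 map_mxM /= [map_mx _ (fc_diff F 0)]minF mulmx0 addr0.
    rewrite hS !map_mxD map_mx1 !map_mxM /= ![map_mx _ (fc_diff F _)]minF.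
    by rewrite mul0mx mulmx0 !addr0.
  have := mulmx1_min fg.
  by rewrite rk0 // leqn0 => /eqP.
pose T := [set j : 'I_(fc_rank G c) | fc_shift G c 0%R j == N].
have -> : (\sum_(j < fc_rank G c) (fc_shift G c 0%R j == N))%N = #|T|.
  by rewrite -sum1_card [RHS]big_mkcond; apply: eq_bigr => j _; rewrite inE; case: eqP.
have gf i (j j' : 'I_(fc_rank G i)) : fc_rank G i.+1 = 0%N ->
    (forall i' l, i'.+1 = i -> (fc_shift G i' 0%R l < fc_shift G i 0%R j)%N) ->
    (constant_mx (g i) *m constant_mx (f i)) j j' = (j == j')%:R.
  move=> rk_next sh_prev; rewrite -map_mxM.
  have hd0 (u : 'M[S]_(fc_rank G i, fc_rank G i.+1)) : u *m fc_diff G i = 0.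
    apply/matrixP => r r'; rewrite !mxE big1 // => l.
    by have := ltn_ord l; rewrite [X in (_ < X)%N]rk_next.
  case: i j j' rk_next sh_prev hd0 => [|i] j j' _ sh_prev hd0.
    by rewrite h0' hd0 addr0 map_mx1 mxE.
  rewrite hS' hd0 addr0 map_mxD map_mx1 map_mxM /= mxE [X in X + _]mxE.
  rewrite [X in _ + X]mxE big1 ?addr0 // => l _.
  (* A nonzero constant entry of the differential would join two generators of equal shift. *)
  rewrite mxE [_@_ _]memN_msupp_eq0 ?mul0r //; apply/negP => /(@gr_homog _ _ _ _ resG i).
  by rewrite mdeg0 add0n => e; have := sh_prev i l erefl; rewrite e ltnn.
(* On the generators of degree [N] the composite is the identity, which therefore factors through a
   space of dimension [betti R c]. *)
pose P := \matrix_(a < #|T|, b < betti R c) constant_mx (g c) (enum_val a) b.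
pose Q := \matrix_(b < betti R c, a < #|T|) constant_mx (f c) b (enum_val a).
have PQ : P *m Q = 1%:M.
  apply/matrixP => a a'; have := enum_valP a; rewrite inE => /eqP aN.
  have := gf c (enum_val a) (enum_val a') (rk0 _ (ltnSn c)).
  rewrite aN => /(_ (fun i l => shN i l)).
  rewrite !mxE (inj_eq enum_val_inj) => <-; apply: eq_bigr => b _.
  by rewrite [P _ _]mxE [Q _ _]mxE.
exact: mulmx1_min PQ.
Qed.

End MinimalResolution.

(** * Resolutions of Stanley-Reisner ideals by deletion and contraction *)

Section MatroidResolution.
Variables (k : fieldType) (n : nat).
Local Notation S := {mpoly k[n]}.
Implicit Types (D : {set {set 'I_n}}) (E F G H : {set 'I_n}) (e : 'I_n) (p q : S).

Lemma SR_ideal_on_ideal D E : (forall F G, G \in D -> F \subset G -> F \in D) ->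
  is_ideal (SR_ideal_on (k := k) D E).
Proof.
move=> DS; split=> [m|p q Ip Iq m|p q Iq m]; first by rewrite msupp0.
  by move=> /msuppD_le; rewrite mem_cat => /orP[/Ip|/Iq].
move=> /msuppM_le/allpairsP[[m1 m2] /= [_ /Iq m2D ->]].
by apply: contraNN m2D => /DS; apply; rewrite suppD setIUl subsetUr.
Qed.

Lemma split_var e p : exists p1 : S,
  (forall m, p1@_m = p@_(m + U_(e))%MM) /\
  (forall m, (p - 'X_e * p1)@_m = if (0 < m e)%N then 0 else p@_m).
Proof.
pose p1 : S := \sum_(m <- msupp p | (0 < m e)%N) p@_m *: 'X_[m - U_(e)].
have p1E m : p1@_m = p@_(m + U_(e))%MM.
  rewrite raddf_sum /= big_mkcond /=.
  have mK : (m + U_(e) - U_(e))%MM = m by rewrite addmK.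
  have me : (0 < (m + U_(e))%MM e)%N by rewrite mnmDE mnm1E eqxx addn1.
  have other u : u != (m + U_(e))%MM ->
      (if (0 < u e)%N then mcoeff m (p@_u *: 'X_[u - U_(e)]) else 0) = 0.
    move=> um; case: ifP => // ue; rewrite mcoeffZ mcoeffX.
    case: (_ =P m) => [uE|_]; last by rewrite mulr0.
    case/eqP: um; rewrite -uE submK //; apply/mnm_lepP => i.
    by rewrite mnm1E; case: eqP => // <-.
  have [mp|mp] := boolP ((m + U_(e))%MM \in msupp p).
    rewrite (bigD1_seq (m + U_(e))%MM) ?msupp_uniq //= big1 ?addr0 => [|u]; last exact: other.
    by rewrite me mcoeffZ mcoeffX mK eqxx mulr1.
  rewrite (memN_msupp_eq0 mp) big_seq big1 // => u up; apply: other.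
  by apply: contraNneq mp => <-.
exists p1; split=> // m; rewrite mcoeffB mulrC; case: ifP => [me|me].
  have mE : m = (m - U_(e) + U_(e))%MM.
    by rewrite submK //; apply/mnm_lepP => i; rewrite mnm1E; case: eqP => // <-.
  have -> : (p1 * 'X_e)@_m = p@_m by rewrite {1}mE addmC mcoeffMX p1E -mE.
  by rewrite subrr.
rewrite [X in _ - X]memN_msupp_eq0 ?subr0 // (perm_mem (msuppMX _ _)).
apply/mapP => -[u _ mE]; move: me.
by rewrite mE mnmDE mnm1E eqxx.
Qed.

Lemma supp_var e (m : 'X_{1..n}) : supp (U_(e) + m)%MM = e |: supp m.
Proof.
rewrite suppD; congr (_ :|: _); apply/setP => i; rewrite !inE mnm1E lt0b.
by rewrite eq_sym.
Qed.

Lemma SR_ideal_on_cone D E e : matroid D -> e \in E -> forall p q,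
  SR_ideal_on D E (p + 'X_e * q) <->
  exists s, SR_ideal_on (del D e) (E :\ e) (p + 'X_e * s) /\
            SR_ideal_on (lnk D e) (E :\ e) (q - s).
Proof.
move=> mD eE p q.
have suppE (m : 'X_{1..n}) : e |: (supp m :&: (E :\ e)) = (e |: supp m) :&: E.
  by apply/setP => i; rewrite !inE; case: eqVneq => [->|].
split=> [Ipq|[s [Js Ls]] m].
  have [r [rE restE]] := split_var e (p + 'X_e * q).
  (* [r] is the quotient of [p + 'X_e * q] by x_e: the remainder, free of x_e, lies in the deletion
     ideal, and [r] in the contraction ideal. *)
  exists (q - r); split.
    rewrite mulrBr addrA => m; rewrite mcoeff_msupp restE.
    case: ifP => [|/negbT]; first by rewrite eqxx.
    rewrite -leqNgt leqn0 => /eqP me; rewrite -mcoeff_msupp => /Ipq; rewrite in_del.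
    have -> : supp m :&: (E :\ e) = supp m :&: E.
      by apply/setP => i; rewrite !inE; case: eqVneq => [->|]; rewrite // me.
    by apply: contraNN => /andP[].
  rewrite opprB addrC subrK => m; rewrite mcoeff_msupp rE -mcoeff_msupp => /Ipq.
  rewrite addmC supp_var in_lnk; apply: contraNN => /andP[_].
  by rewrite suppE.
have -> : p + 'X_e * q = (p + 'X_e * s) + 'X_e * (q - s) by ring.
move/msuppD_le; rewrite mem_cat => /orP[/Js|].
  apply: contraNN => mED; rewrite in_del !inE eqxx andbF andbT.
  by apply: matroidS mD mED _; apply: setIS; apply: subsetDl.
rewrite mulrC (perm_mem (msuppMX _ _)) => /mapP[u /Ls uL ->].
by rewrite supp_var -suppE; apply: contraNN uL; rewrite in_lnk !inE eqxx andbF.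
Qed.

(** Over the empty ground set no monomial is a nonface: the ideal is zero and S resolves itself. *)
Lemma point_resolution D : D = [set set0] ->
  exists2 F : free_complex k n, graded_resolution (SR_ideal_on D set0) F
    & [/\ fc_rank F 0 = 1%N, forall i, fc_rank F i.+1 = 0%N
        & forall i j, fc_shift F i 0 j = 0%N].
Proof.
move=> ->; pose F : free_complex k n := FreeComplex (fc_rank := fun i => (i == 0) : nat)
  (fun=> 0) (fun=> 0) (const_mx 1).
have I0 p : SR_ideal_on [set set0] set0 p <-> p = 0.
  split=> [Ip|-> m]; last by rewrite msupp0.
  apply: msuppnil0; move: Ip; rewrite /SR_ideal_on; case: (msupp p) => // m s /(_ m).
  by rewrite mem_head setI0 set11 => /(_ isT).
exists F; last by split=> // i j; rewrite mxE.
split=> /=.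
- by move=> i; apply: homogeneous_mx0.
- move=> r c u; rewrite !mxE mcoeff_msupp mcoeff1.
  by case: (u =P 0%MM) => [-> _|_]; rewrite ?mdeg0 ?eqxx.
- move=> w; rewrite I0; split=> [w0|[v ->]]; last by rewrite mulmx0 mul0mx mxE.
  exists 0; rewrite mul0mx; apply/rowP => c; rewrite (ord1 c) mxE -[RHS]w0 mxE big_ord1.
  by rewrite mxE mulr1.
- move=> i w; split=> _; last by rewrite mulmx0.
  by exists 0; rewrite mul0mx; apply/rowP; case.
exists (const_mx 1).
  move=> r c u; rewrite !mxE mcoeff_msupp mcoeff1.
  by case: (u =P 0%MM) => [-> _|_]; rewrite ?mdeg0 ?eqxx.
by apply/I0; rewrite mxE big_ord1 !mxE mulr1 subrr.
Qed.

Lemma zero_resolution (I : S -> Prop) : (forall p, I p) ->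
  exists2 F : free_complex k n, graded_resolution I F & forall i, fc_rank F i = 0%N.
Proof.
move=> IT; exists (FreeComplex (fc_rank := fun=> 0%N) (fun=> 0) (fun=> 0) 0) => //.
split=> /=.
- by move=> i; apply: homogeneous_mx0.
- exact: homogeneous_mx0.
- by move=> w; split=> // _; exists 0; apply/rowP; case.
- move=> i w; split=> _; last by apply/rowP; case.
  by exists 0; apply/rowP; case.
by exists 0 => //; apply: homogeneous_mx0.
Qed.

Definition top_generators (F : free_complex k n) c N : nat :=
  \sum_(j < fc_rank F c) (fc_shift F c 0%R j == N).

(** The two summands of the count mirror the contraction and deletion terms in the recursion for
    [tau]; both sit in the cone with their degrees raised by one. *)
Lemma top_generators_cone e A B (phi : forall i, 'M[S]_(fc_rank A i, fc_rank B i)) c N :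
  fc_rank A c.+1 = 0%N ->
  top_generators (cone e phi) c.+1 N.+1 = (top_generators B c.+1 N + top_generators A c N)%N.
Proof.
move=> A0; rewrite /top_generators /= !big_split_ord /=.
rewrite [X in (X + _ + _)%N]big1 ?add0n => [|i _]; last first.
  by have := ltn_ord i; rewrite [X in (_ < X)%N]A0.
by congr (_ + _)%N; apply: eq_bigr => i _; rewrite ?row_mxEl ?row_mxEr mxE eqSS.
Qed.

Lemma top_generators0 (F : free_complex k n) c N :
  fc_rank F c = 0%N -> top_generators F c N = 0%N.
Proof.
move=> F0; rewrite /top_generators big1 // => i _.
by have := ltn_ord i; rewrite [X in (_ < X)%N]F0.
Qed.

(* Deletion and contraction of e give the ideals J and L of cone_resolution; a
   loop e contracts to L = S. *)
Lemma matroid_resolution D E : matroid D -> (forall F, F \in D -> F \subset E) ->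
  exists2 F, graded_resolution (SR_ideal_on D E) F
    & [/\ forall i, (#|E| - complex_rank D < i)%N -> fc_rank F i = 0%N,
          forall i j, (fc_shift F i 0%R j <= i + complex_rank D)%N
        & tau D <= (top_generators F (#|E| - complex_rank D) #|E|)%:Z].
Proof.
have [N] := ubnP #|E|; elim: N D E => // N IHN D E ltN mD DE.
have [E0|[e eE]] := set_0Vmem E.
  have D0 : D = [set set0].
    apply/setP => F; rewrite inE; apply/idP/eqP => [/DE|->]; last exact: matroid0.
    by rewrite E0 subset0 => /eqP.
  have [F resF [F0 FS Fsh]] := point_resolution D0.
  exists F; rewrite E0 // D0 rank_set0 tau_set0 cards0; split=> [[]||] //.
    by move=> i j; rewrite Fsh.
  rewrite /top_generators (eq_bigr (fun=> 1%N)) => [|j _]; last by rewrite Fsh.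
  by rewrite sum_nat_const card_ord F0.
have cE : #|E| = #|E :\ e|.+1 by rewrite (cardsD1 e) eE.
have ltN' : (#|E :\ e| < N)%N by rewrite cE in ltN.
have [cl|ncl] := boolP (coloop D e).
  (* A coloop does not change the ideal, so the resolution is reused; the bound on top generators is
     trivial since [tau D] is 0. *)
  have eD := coloop1 mD cl; have mL := lnk_matroid mD eD.
  have [F resF [F0 Fsh _]] := IHN _ _ ltN' mL (lnk_sub DE).
  have rkE := rank_lnk mD eD.
  exists F; last first.
    split=> [i|i j|]; rewrite ?cE rkE ?subSS; first exact: F0.
      by apply: leq_trans (Fsh i j) _; rewrite leq_add2l.
    by rewrite (tau_coloop mD cl).
  suff eqI p : SR_ideal_on (lnk D e) (E :\ e) p <-> SR_ideal_on D E p.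
    exact: eq_graded_resolution eqI resF.
  by split=> Ip m /Ip; rewrite coloop_lnk_trace.
have mde := del_matroid e mD; have rkd := rank_del mD ncl.
have rkd_le : (complex_rank (del D e) <= #|E :\ e|)%N.
  by apply/bigmax_leqP => F /(del_sub DE)/subset_leq_card.
have [A resA [A0 Ash Atop]] := IHN _ _ ltN' mde (del_sub DE).
set c := (#|E :\ e| - complex_rank D)%N.
have cE' : (#|E| - complex_rank D = c.+1)%N by rewrite cE subSn // -rkd.
rewrite rkd -/c in A0 Ash Atop.
(* Contraction of a nonloop has corank [c.+1] and rank one less, whence the strict bound on shifts.
   For a loop [B] is zero and [del D e] is [D], so the same estimates hold. *)
have [B resB [B0 Bsh Btop]] : exists2 B, graded_resolution (SR_ideal_on (lnk D e) (E :\ e)) B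
    & [/\ forall i, (c.+1 < i)%N -> fc_rank B i = 0%N,
          forall i j, (fc_shift B i 0%R j < i + complex_rank D)%N
        & tau D <= tau (del D e) + (top_generators B c.+1 #|E :\ e|)%:Z].
  have [eD|eD] := boolP ([set e] \in D).
    have rkl := rank_lnk mD eD.
    have [B resB [B0 Bsh Btop]] := IHN _ _ ltN' (lnk_matroid mD eD) (lnk_sub DE).
    have cl : (#|E :\ e| - complex_rank (lnk D e) = c.+1)%N.
      by rewrite -cE' cE rkl subSS.
    rewrite cl in B0 Btop.
    exists B => //; split=> // [i j|]; first by rewrite rkl addnS ltnS.
    by rewrite (tau_nonloop mD eD ncl) lerD2l.
  have L0 : lnk D e = set0.
    apply/setP => F; rewrite in_lnk inE; apply/negP => /andP[_ eFD].
    by case/negP: eD; apply: matroidS mD eFD _; apply: subsetUl.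
  have [|B resB B0] := @zero_resolution (SR_ideal_on (lnk D e) (E :\ e)).
    by move=> p m _; rewrite L0 inE.
  exists B => //; split=> // [i j|]; first by have := ltn_ord j; rewrite [X in (_ < X)%N]B0.
  rewrite top_generators0 // addr0 (_ : del D e = D) //.
  apply/setP => F; rewrite in_del; case FD: (F \in D) => //=.
  by apply: contraNN eD => eF; apply: matroidS mD FD _; rewrite sub1set.
have [| | | | |phi resC] :=
  cone_resolution (e := e) (I := SR_ideal_on D E) _ _ _ _ _ resA resB.
- by apply: SR_ideal_on_ideal => F G; apply: matroidS mde.
- apply: SR_ideal_on_ideal => F G; rewrite !in_lnk => /andP[eG eGD] sFG.
  by rewrite (contraNN (subsetP sFG e)) // (matroidS mD eGD) // setUS.
- move=> p Jp m /Jp; apply: contraNN; rewrite in_lnk in_del => /andP[-> eFD].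
  by rewrite (matroidS mD eFD) // subsetUr.
(* Multiplication by x_e leaves the trace of a support on [E :\ e] unchanged, so x_e is a
   nonzerodivisor modulo the deletion ideal. *)
- move=> p Jp m mp; have := Jp (U_(e) + m)%MM.
  rewrite mulrC (perm_mem (msuppMX _ _)) map_f // supp_var => /(_ isT).
  rewrite (_ : (e |: supp m) :&: _ = supp m :&: (E :\ e)) //.
  by apply/setP => i; rewrite !inE; case: eqVneq => //=; rewrite andbF.
- exact: SR_ideal_on_cone.
exists (cone e phi) => //; rewrite cE'; split.
- move=> i lti /=; rewrite A0 ?B0 //; last by lia.
  by case: i lti => // i lti /=; rewrite A0.
- move=> i j; rewrite /=; case: (split_ordP j) => {}j ->; rewrite ?row_mxEl ?row_mxEr.
    case: (split_ordP j) => {}j ->; first by rewrite row_mxEl.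
    by rewrite row_mxEr mxE; apply: Bsh.
  case: i j => [|i] j; first by case: j.
  by rewrite /= mxE addSn ltnS.
rewrite cE top_generators_cone ?A0 // PoszD.
by apply: le_trans Btop _; rewrite addrC lerD2l.
Qed.

End MatroidResolution.

Theorem theorem4p5 (k : fieldType) (n : nat) (Delta : {set {set 'I_n}})
    (Delta_matroid : matroid Delta)
    (h : seq int) (h_vec : is_h_vector k Delta h) :
  (forall t : nat, is_type (@SR_ideal k n Delta) t -> (t <= 3)%N ->
     pure_O_sequence h) /\
  (h`_0 = 1 -> last 0 h <= 3 -> pure_O_sequence h).
Proof.
have [D [E [[mD DE cf] [rkD numD trace]]]] :=
  contract_coloops Delta_matroid (fun F _ => subsetT F).
have numE := h_vector_numerator Delta_matroid h_vec.
rewrite cardsT card_ord in rkD.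
have cancel_power (p q : {poly int}) :
    (1 - 'X) ^+ (#|E| - complex_rank D) * p = (1 - 'X) ^+ (#|E| - complex_rank D) * q -> p = q.
  by apply: mulfI; rewrite expf_neq0 // -oppr_eq0 opprB -polyC1 polyXsubC_eq0.
have tau_D := tau_gt0 mD cf.
have last_h : last 0 h = tau D.
  apply: last_h_polynomial; [exact: h_vec.1| |by rewrite gt_eqF].
  by apply: cancel_power; rewrite -numerator_h_polynomial // numD rkD.
have pure_h : tau D <= 3 -> pure_O_sequence h.
  move=> tau3; apply: pure_degree_polyP; first exact: h_vec.1.
  have [p pure_p numDp] := matroid_numerator mD DE (fun=> ltn0Sn 0) cf tau3.
  suff -> : Poly h = p by [].
  by apply: cancel_power; rewrite -numDp numD rkD.
split=> [t [R [p [<- tR_neq0 R_above]]] le3|_]; last by rewrite last_h.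
apply: pure_h.
have SRE (q : {mpoly k[n]}) : SR_ideal_on D E q <-> SR_ideal Delta q.
  rewrite (SR_idealP Delta_matroid.1).
  by split=> Iq m /Iq; rewrite trace.
have iSR : is_ideal (@SR_ideal k n Delta).
  have [I0 ID IM] := @SR_ideal_on_ideal k n D E (fun F G => @matroidS _ _ _ _ mD).
  split=> [|q1 q2 /SRE q1I /SRE q2I|q1 q2 /SRE q2I]; apply/SRE => //; [exact: ID|exact: IM].
have [F /(eq_graded_resolution SRE) resF [F0 Fsh Ftop]] := @matroid_resolution k n D E mD DE.
have rkE : (complex_rank D <= #|E|)%N.
  by apply/bigmax_leqP => G /DE/subset_leq_card.
have [|R0 Rtop] := minimal_resolution_bound (N := #|E|) R iSR resF F0.
  by move=> i j ic; apply: leq_ltn_trans (Fsh i j) _; lia.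
have tau_R := le_trans Ftop (Rtop : _%:Z <= _%:Z).
(* [p] is known only as an index with nonzero Betti number and zeros above it. It cannot lie below
   the corank, where the Betti number is at least [tau D > 0], nor above it, where all vanish. *)
case: (ltngtP p (#|E| - complex_rank D)%N) => [/R_above R_c|/R0 R_p|pE].
- by move: (lt_le_trans tau_D tau_R); rewrite R_c.
- by rewrite R_p in tR_neq0.
by rewrite pE in le3; apply: le_trans tau_R _.
Qed.
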